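(* Let $\vec p=(p_I,p_X,p_Y,p_Z)$ be a fixed probability vector and $h(\vec p)=-p_I\log p_I-p_X\log p_X-p_Y\log p_Y-p_Z\log p_Z$. Let $\delta>0$, and let $k=k_n$, $\varepsilon=\varepsilon_n$ satisfy $k/n\le1-h(\vec p)-\delta$ and $\lim_{n\to\infty}\frac{\log n}{\log(n/\varepsilon)}=0$. Then for all sufficiently large $n$ the expected Choi error of the random codes formed by $\mathfrak C_n^\varepsilon$ against the strength-$\vec p$ local Pauli noise channel satisfies $$\mathbb E_{U\sim\mathfrak C_n^\varepsilon}\epsilon_{\mathrm{Choi}}\le\sqrt{8\delta+\sqrt{2^{-n(1-h(\vec p)-\frac kn-\delta)}+\frac{4\varepsilon^{1-\frac kn}n^{\frac kn}}{\log(n/\varepsilon)}}}.$$ That is, 1D $\omega(\log n)$-depth double-layer blocked circuits can achieve the hashing bound $1-h(\vec p)$: for every constant $0<R<1-h(\vec p)$, with $k/n\to R$ and $\log(n/\varepsilon)=\omega(\log n)$, the expected Choi error tends to $0$ as $n\to\infty$.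
   Context: All logarithms are base 2 ($0\log0=0$). Double-layer blocked ensemble $\mathfrak C_n^\varepsilon$: $n$ qubits on a line are divided into $2N$ consecutive regions of $\xi=n/2N$ qubits each, with $\xi=\log(n/\varepsilon)$. $U=U_2U_1$ with $U_1=\bigotimes_{i=1}^NU_C^{2i-1,2i}$, $U_2=\bigotimes_{i=1}^{N-1}U_C^{2i,2i+1}$, where the $U_C^{j,j+1}$ are independent uniformly random Clifford unitaries on the $2\xi$ qubits of regions $j,j+1$. Such a Clifford is implementable in 1D depth $O(\xi)$, so the circuit depth is $O(\log(n/\varepsilon))$. Each region contains $\frac kn\xi$ logical qubits and $\frac{n-k}n\xi$ ancillas in $|0\rangle$. Parameters are such that all these numbers are integers. Choi error: $L$ is the $k$-qubit logical system, $S$ the $n$-qubit physical system, $R$ a $k$-qubit reference, $\hat\phi_{LR}$ the maximally entangled state, $\mathcal E(\rho)=U(\rho\otimes|0^{n-k}\rangle\langle0^{n-k}|)U^\dagger$. For a noise channel $\mathcal N$ on $S$, $\epsilon_{\mathrm{Choi}}=\min_{\mathcal D}P(\hat\phi_{LR},[(\mathcal D\circ\mathcal N\circ\mathcal E)_L\otimes I_R](\hat\phi_{LR}))$ over quantum channels $\mathcal D$ to $L$, with $P=\sqrt{1-F^2}$, $F(\rho,\sigma)=\Vert\sqrt\rho\sqrt\sigma\Vert_1$. Strength-$\vec p$ local Pauli noise: $\mathcal N=\mathcal N_p^{\otimes n}$, $\mathcal N_p(\rho)=p_I\rho+p_XX\rho X+p_YY\rho Y+p_ZZ\rho Z$. 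*)

(* Defs.v *)
From HB Require Import structures.
From mathcomp Require Import all_boot all_order all_algebra.
From mathcomp Require Import all_classical all_reals all_analysis.
From mathcomp Require Import complex.

Set Implicit Arguments.
Unset Strict Implicit.
Unset Printing Implicit Defensive.

Import Order.TTheory GRing.Theory Num.Theory.
Import numFieldNormedType.Exports.

Local Open Scope classical_set_scope.
Local Open Scope sesquilinear_scope.
Local Open Scope complex_scope.
Local Open Scope ring_scope.

(* The Hilbert space with orthonormal basis a finite type T; its operators    *)
(* are square matrices whose rows and columns are indexed by T via enum_rank. *)
Notation endo R T := 'M[R[i]]_#|{: T}|.

(* The computational basis of n qubits. *)
Notation qubits n := {ffun 'I_n -> bool}.

Section Operators.
Variable R : realType.

Definition opmx (T : finType) (f : T -> T -> R[i]) : endo R T :=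
  \matrix_(a, b) f (enum_val a) (enum_val b).

Definition coef (T : finType) (A : endo R T) (s t : T) : R[i] :=
  A (enum_rank s) (enum_rank t).

(* |s><t| *)
Definition ketbra (T : finType) (s t : T) : endo R T :=
  delta_mx (enum_rank s) (enum_rank t).

(* 0 <= z in R[i] forces z to be real, so a psd matrix is Hermitian. *)
Definition psd (m : nat) (A : 'M[R[i]]_m) : Prop :=
  forall v : 'rV[R[i]]_m, 0 <= (v *m A *m v^t*) ord0 ord0.

(* The square root by functional calculus; only meaningful on psd matrices. *)
Definition sqrtmx (m : nat) (A : 'M[R[i]]_m) : 'M[R[i]]_m :=
  invmx (spectralmx A) *m diag_mx (map_mx sqrtC (spectral_diag A))
    *m spectralmx A.

Definition trace_norm (m : nat) (A : 'M[R[i]]_m) : R :=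
  complex.Re (\tr (sqrtmx (A^t* *m A))).

Definition fidelity (m : nat) (rho sigma : 'M[R[i]]_m) : R :=
  trace_norm (sqrtmx rho *m sqrtmx sigma).

Definition purified_distance (m : nat) (rho sigma : 'M[R[i]]_m) : R :=
  Num.sqrt (1 - fidelity rho sigma ^+ 2).

(* Phi (x) id_E, applied blockwise: the (e, e') block of X, an operator on S, *)
(* is mapped through Phi.                                                     *)
Definition tens_id (S L E : finType) (Phi : endo R S -> endo R L)
    (X : endo R (S * E)) : endo R (L * E) :=
  opmx (fun le le' =>
    coef (Phi (opmx (fun s s' => coef X (s, le.2) (s', le'.2)))) le.1 le'.1).

Definition completely_positive (S L : finType) (Phi : endo R S -> endo R L) :=
  forall (m : nat) (X : endo R (S * 'I_m)), psd X -> psd (tens_id Phi X).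

Definition trace_preserving (S L : finType) (Phi : endo R S -> endo R L) :=
  forall A, \tr (Phi A) = \tr A.

Definition quantum_channel (S L : finType)
    (Phi : {linear endo R S -> endo R L}) : Prop :=
  completely_positive Phi /\ trace_preserving Phi.

(* The density operator of #|L|^(-1/2) \sum_l |l>|l> on L (x) R, with R a copy *)
(* of L.                                                                       *)
Definition max_entangled (L : finType) : endo R (L * L) :=
  opmx (fun a b => ((a.1 == a.2) && (b.1 == b.2))%:R / #|L|%:R).

(* The Choi error of the noisy encoding NE = N o E from L to S. The infimum   *)
(* over recovery channels is a minimum, as the set of channels is compact.    *)
Definition choi_error (L S : finType) (NE : endo R L -> endo R S) : R :=
  inf [set purified_distance (max_entangled L)
             (tens_id (D \o NE) (max_entangled L))
      | D in [set D : {linear endo R S -> endo R L} | quantum_channel D]].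

(* 0, 1, 2, 3 : 'I_4 stand for I, X, Y, Z. *)
Definition pauli1 (w : 'I_4) : endo R bool :=
  opmx (fun a b => match val w with
    | 0%N => (a == b)%:R
    | 1%N => (a != b)%:R
    | 2%N => if a == b then 0 else if a then 'i%C else - 'i%C
    | _ => if a == b then (-1) ^+ a else 0
    end).

Definition pauli (m : nat) (w : {ffun 'I_m -> 'I_4}) : endo R (qubits m) :=
  opmx (fun s t : qubits m => \prod_q coef (pauli1 (w q)) (s q) (t q)).

Definition pauli_noise1 (p : 'I_4 -> R) (rho : endo R bool) : endo R bool :=
  \sum_(w < 4) (p w)%:C *: (pauli1 w *m rho *m pauli1 w).

(* The n-fold tensor power of a map N on one qubit, the linear extension of   *)
(* |s><t| |-> (x)_q N(|s_q><t_q|).                                            *)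
Definition tens_power (n : nat) (N : endo R bool -> endo R bool)
    (rho : endo R (qubits n)) : endo R (qubits n) :=
  opmx (fun s' t' : qubits n => \sum_s \sum_t coef rho s t *
    \prod_(q < n) coef (N (ketbra (s q) (t q))) (s' q) (t' q)).

Definition pauli_noise (n : nat) (p : 'I_4 -> R) :
    endo R (qubits n) -> endo R (qubits n) :=
  @tens_power n (pauli_noise1 p).

Definition pauli_group (m : nat) : set (endo R (qubits m)) :=
  [set P | exists (a : 'I_4) (w : {ffun 'I_m -> 'I_4}), P = 'i%C ^+ a *: pauli w].

Definition clifford (m : nat) : set (endo R (qubits m)) :=
  [set U | U \is unitarymx /\
     forall P, pauli_group P -> pauli_group (U *m P *m U^t*)].

(* tau tabulates the conjugation action of U on Pauli strings, together with  *)
(* the power of 'i appearing in the image.                                    *)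
Definition conj_action (m : nat) (U : endo R (qubits m))
    (tau : {ffun {ffun 'I_m -> 'I_4} -> 'I_4 * {ffun 'I_m -> 'I_4}}) : Prop :=
  forall w, U *m pauli w *m U^t* = 'i%C ^+ (tau w).1 *: pauli (tau w).2.

(* The Clifford group modulo global phases, a finite group: an element is     *)
(* represented by its conjugation action. By clifford_has_action,             *)
(* conj_action_inj and eq_conj_action below, every Clifford U has exactly one *)
(* action, and the Cliffords with the same action as U are its multiples by   *)
(* a phase.                                                                   *)
Definition clifford_class (m : nat) :=
  {tau : {ffun {ffun 'I_m -> 'I_4} -> 'I_4 * {ffun 'I_m -> 'I_4}}
       | `[< exists2 U, clifford U & conj_action U tau >]}.

(* A unitary in the class; its phase is arbitrary. *)
Definition clifford_mx (m : nat) (g : clifford_class m) : endo R (qubits m) :=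
  xget 0 [set U | clifford U /\ conj_action U (val g)].


Lemma coef_opmx (T : finType) (f : T -> T -> R[i]) s t :
  coef (opmx f) s t = f s t.
Proof. by rewrite /coef mxE !enum_rankK. Qed.

Lemma coefM (T : finType) (A B : endo R T) s t :
  coef (A *m B) s t = \sum_u coef A s u * coef B u t.
Proof.
rewrite /coef mxE (reindex enum_rank) //=.
by apply: onW_bij; exact: enum_rank_bij.
Qed.

Lemma coef_inj (T : finType) (A B : endo R T) :
  (forall s t, coef A s t = coef B s t) -> A = B.
Proof.
move=> h; apply/matrixP => a b.
by have := h (enum_val a) (enum_val b); rewrite /coef !enum_valK.
Qed.

Lemma coef_scale (T : finType) c (A : endo R T) s t :
  coef (c *: A) s t = c * coef A s t.
Proof. by rewrite /coef mxE. Qed.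

Lemma coef_scalar (T : finType) (c : R[i]) (s t : T) :
  coef c%:M s t = c *+ (s == t).
Proof. by rewrite /coef mxE (inj_eq enum_rank_inj). Qed.

Lemma pauli_commutant (m : nat) (W : endo R (qubits m)) :
  (forall w, W *m pauli w = pauli w *m W) -> exists c, W = c%:M.
Proof.
move=> hW.
have diag s t : s != t -> coef W s t = 0.
  move=> st; have [q hq] : exists q, s q != t q.
    by apply/existsP; apply: contraR st; rewrite negb_exists => /forallP h;
       apply/eqP/ffunP => q; have := h q; rewrite negbK => /eqP.
  pose w : {ffun 'I_m -> 'I_4} := [ffun r => if r == q then ord_max else ord0].
  have hw u v : coef (pauli w) u v = if u == v then (-1) ^+ (u q) else 0.
    rewrite coef_opmx; case: eqP => [<-|/eqP uv].
      rewrite (bigD1 q) //= big1 ?mulr1 ?ffunE ?eqxx ?coef_opmx ?eqxx //.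
      by move=> r rq; rewrite ffunE (negbTE rq) coef_opmx /= eqxx.
    have [r hr] : exists r, u r != v r.
      by apply/existsP; apply: contraR uv; rewrite negb_exists => /forallP h;
         apply/eqP/ffunP => r; have := h r; rewrite negbK => /eqP.
    rewrite (bigD1 r) //= ffunE.
    by case: eqP => _; rewrite coef_opmx /= (negbTE hr) mul0r.
  have := congr1 (fun A => coef A s t) (hW w).
  rewrite !coefM (bigD1 t) //= big1 ?addr0; last first.
    by move=> u ut; rewrite hw (negbTE ut) mulr0.
  rewrite (bigD1 s) //= big1 ?addr0; last first.
    by move=> u us; rewrite hw eq_sym (negbTE us) mul0r.
  rewrite !hw !eqxx => /eqP; rewrite mulrC -subr_eq0 -mulrBl mulf_eq0.
  case/orP => [|/eqP //]; move: hq.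
  by case: (s q) (t q) => [] [] //= _;
     rewrite ?expr1 ?expr0 ?opprK -?opprD ?oppr_eq0 (pnatr_eq0 _ 2).
have const s t : coef W s s = coef W t t.
  pose w : {ffun 'I_m -> 'I_4} :=
    [ffun r => if s r == t r then ord0 else inord 1].
  have hw u v : coef (pauli w) u v =
      [forall r, (u r == v r) == (s r == t r)]%:R.
    rewrite coef_opmx; case: forallP => [h|h].
      rewrite big1 // => r _; rewrite ffunE; have /eqP := h r.
      by case: (s r == t r) => e; rewrite coef_opmx /= ?inordK //= e.
    have [r hr] : exists r, (u r == v r) != (s r == t r).
      apply/existsP; apply: contraT => /existsPn h'; case: h => r.
      by have := h' r; rewrite negbK.
    rewrite (bigD1 r) //= ffunE; move: hr.
    case: (s r == t r) => e; rewrite coef_opmx /= ?inordK //=;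
      by case: (u r == v r) e => //= _; rewrite mul0r.
  have := congr1 (fun A => coef A s t) (hW w).
  rewrite !coefM (bigD1 s) //= big1 ?addr0; last first.
    by move=> u us; rewrite diag ?mul0r // eq_sym.
  rewrite (bigD1 t) //= big1 ?addr0; last first.
    by move=> u ut; rewrite diag ?mulr0.
  have -> : coef (pauli w) s t = 1.
    by rewrite hw; case: forallP => // -[] r; rewrite eqxx.
  by rewrite mulr1 mul1r.
pose o : qubits m := [ffun=> false].
exists (coef W o o); apply: coef_inj => s t; rewrite coef_scalar.
by case: eqP => [<-|/eqP /diag //]; exact: const.
Qed.

Lemma pauli1_prop_inj (x y : 'I_4) (d : R[i]) :
  (forall a b, coef (pauli1 x) a b = d * coef (pauli1 y) a b) -> x = y.
Proof.
have ii : 'i%C = - 'i%C :> R[i] -> False.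
  by move=> /eqP; rewrite -addr_eq0 -mulr2n mulrn_eq0 /= eq_complex /= oner_eq0 andbF.
have i0 : 'i%C = 0 :> R[i] -> False.
  by move/eqP; rewrite eq_complex /= oner_eq0 andbF.
have m1 : 1 = -1 :> R[i] -> False.
  by move=> /eqP; rewrite -addr_eq0 (pnatr_eq0 _ 2).
have o0 : 1 = 0 :> R[i] -> False by move/eqP; rewrite oner_eq0.
move=> h; move: (h false false) (h false true) (h true false) (h true true).
rewrite !coef_opmx {h}.
case: x => [[|[|[|[|//]]]] hx]; case: y => [[|[|[|[|//]]]] hy] /=;
  rewrite ?expr0 ?expr1 ?mulr0 ?mulr1 ?mulrN1 ?mulrN => e1 e2 e3 e4;
  try (by apply: val_inj); exfalso;
  try (by apply: o0); try (by apply: i0).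
all: try exact: m1 (etrans e4 (congr1 -%R (esym e1))).
all: try exact: m1 (etrans e1 (esym e4)).
all: try exact: m1 (etrans e2 (congr1 -%R (esym e3))).
all: try exact: ii (etrans e3 (esym e2)).
Qed.

Lemma phase_inj (a b : 'I_4) : 'i%C ^+ a = 'i%C ^+ b :> R[i] -> a = b.
Proof.
have e1 : (1 == -1 :> R) = false by rewrite -addr_eq0 (pnatr_eq0 _ 2).
have e1' : (-1 == 1 :> R) = false by rewrite eq_sym.
case: a => [[|[|[|[|//]]]] ha]; case: b => [[|[|[|[|//]]]] hb] //= /eqP;
  rewrite /= ?exprS ?expr0 ?mulr1 eq_complex /= ?(mulr0, mul0r, mulr1, mul1r, subr0, sub0r, addr0, add0r, oppr0, mulrN1, mulN1r) ?(oner_eq0, oppr_eq0, eqxx, e1, e1', andbF, eq_sym 0) //= => e;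
  try exact: val_inj.
Qed.

Lemma pauli_phase_inj (m : nat) (a b : 'I_4) (x y : {ffun 'I_m -> 'I_4}) :
  'i%C ^+ a *: pauli x = 'i%C ^+ b *: pauli y :> endo R _ -> a = b /\ x = y.
Proof.
have i0 : 'i%C != 0 :> R[i] by rewrite eq_complex /= oner_eq0 andbF.
have ia0 (c : 'I_4) : 'i%C ^+ c != 0 :> R[i] by rewrite expf_neq0.
move=> h; pose fl (w : 'I_4) := (w == 1%N :> nat) || (w == 2%N :> nat).
have nz w : coef (pauli1 w) false (fl w) != 0.
  rewrite coef_opmx; case: w => [[|[|[|[|//]]]] hw] //=;
  by rewrite ?expr0 ?oner_eq0 ?oppr_eq0.
have E s t := congr1 (fun A => coef A s t) h.
have xy : x = y.
  apply/ffunP => q.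
  pose K := \prod_(r | r != q) coef (pauli1 (x r)) false (fl (x r)).
  pose K' := \prod_(r | r != q) coef (pauli1 (y r)) false (fl (x r)).
  have K0 : K != 0 by rewrite prodf_seq_neq0; apply/allP => r _; apply/implyP.
  apply: (@pauli1_prop_inj _ _ (('i%C ^+ a * K)^-1 * ('i%C ^+ b * K'))) => u v.
  have := E [ffun r => if r == q then u else false]
            [ffun r => if r == q then v else fl (x r)].
  rewrite !coef_scale !coef_opmx (bigD1 q) //= [in RHS](bigD1 q) //= !ffunE eqxx.
  rewrite (eq_bigr (fun r => coef (pauli1 (x r)) false (fl (x r)))); last first.
    by move=> r rq; rewrite !ffunE (negbTE rq).
  rewrite [in RHS](eq_bigr (fun r => coef (pauli1 (y r)) false (fl (x r)))); last first.
    by move=> r rq; rewrite !ffunE (negbTE rq).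
  rewrite -/K -/K' => e; apply: (mulfI (mulf_neq0 (ia0 a) K0)).
  rewrite [RHS]mulrA mulVKf ?mulf_neq0 // -!mulrA ![K * _]mulrC ![K' * _]mulrC.
  by move: e; rewrite !coef_opmx.
split=> //; apply: phase_inj; move: (E [ffun=> false] [ffun r => fl (x r)]).
rewrite -xy !coef_scale => /mulIf; apply.
rewrite coef_opmx prodf_seq_neq0; apply/allP => r _; apply/implyP => _.
by rewrite !ffunE.
Qed.

Lemma conj_action_inj (m : nat) (U : endo R (qubits m)) tau tau' :
  conj_action U tau -> conj_action U tau' -> tau = tau'.
Proof.
move=> h h'; apply/ffunP => w.
have [] := @pauli_phase_inj m (tau w).1 (tau' w).1 (tau w).2 (tau' w).2.
  by rewrite -h h'.
by case: (tau w) (tau' w) => [? ?] [? ?] /= -> ->.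
Qed.

Lemma clifford_has_action (m : nat) (U : endo R (qubits m)) :
  clifford U -> exists tau, conj_action U tau.
Proof.
case=> _ hU.
have h w : exists av : 'I_4 * {ffun 'I_m -> 'I_4},
    U *m pauli w *m U^t* = 'i%C ^+ av.1 *: pauli av.2.
  have [|a [v hv]] := hU (pauli w); last by exists (a, v).
  by exists ord0, w; rewrite expr0 scale1r.
have [f hf] := choice h.
by exists [ffun w => f w] => w; rewrite ffunE.
Qed.

Lemma eq_conj_action (m : nat) (U V : endo R (qubits m)) tau :
  U \is unitarymx -> V \is unitarymx -> conj_action U tau ->
  conj_action V tau <-> exists2 c : R[i], `|c| = 1 & V = c *: U.
Proof.
move=> uU uV hU.
have UU := unitarymxP uU; have VV := unitarymxP uV.
have U'U := mulmx1C UU; have V'V := mulmx1C VV.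
split=> [hV|[c c1 ->] w].
  have [w|c hc] := @pauli_commutant m (U^t* *m V).
    have := hV w; rewrite -hU => /(congr1 (fun A => U^t* *m A *m V)).
    by rewrite !mulmxA U'U mul1mx -!mulmxA V'V mulmx1 => ->.
  have VE : V = c *: U.
    have := congr1 (mulmx U) hc.
    by rewrite mulmxA UU mul1mx mul_mx_scalar.
  exists c => //; move: VV; rewrite VE linearZ /= map_mxZ -scalemxAl -scalemxAr.
  rewrite UU scalerA -normCK => /matrixP.
  move/(_ (enum_rank [ffun=> false]) (enum_rank [ffun=> false])).
  rewrite !mxE eqxx mulr1n mulr1 => /eqP.
  by rewrite sqrp_eq1 // => /eqP.
rewrite linearZ /= map_mxZ -!scalemxAl -!scalemxAr scalerA -normCK c1.
by rewrite expr1n scale1r.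
Qed.

End Operators.

Section DoubleLayerBlocked.
Variable R : realType.

Definition log2 (x : R) : R := ln x / ln 2.

Definition entropy (p : 'I_4 -> R) : R := - \sum_(w < 4) p w * log2 (p w).

Definition prob_vector (p : 'I_4 -> R) : Prop :=
  (forall w, 0 <= p w) /\ \sum_(w < 4) p w = 1.

(* The value of the qubit at position q, false when q is out of range. *)
Definition bit (n : nat) (s : qubits n) (q : nat) : bool :=
  oapp s false (insub q).

Definition window (n m o : nat) (s : qubits n) : qubits m :=
  [ffun a : 'I_m => bit s (o + a)].

(* V acting on the qubits o, ..., o + m - 1, tensored with the identity. *)
Definition embed (n m o : nat) (V : endo R (qubits m)) : endo R (qubits n) :=
  opmx (fun s t : qubits n =>
    if [forall q : 'I_n, ~~ (o <= q < o + m)%N ==> (s q == t q)]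
    then coef V (window m o s) (window m o t) else 0).

(* Regions, of xi qubits each, are numbered from 0; the gate V j acts on      *)
(* regions j and j+1. The first layer consists of the gates with j even, the  *)
(* second one of those with j odd.                                            *)
Definition blocked_circuit (n xi : nat)
    (V : 'I_(n %/ xi).-1 -> endo R (qubits (2 * xi))) : endo R (qubits n) :=
  (\prod_(j < (n %/ xi).-1 | odd j) embed n (j * xi) (V j)) *m
  (\prod_(j < (n %/ xi).-1 | ~~ odd j) embed n (j * xi) (V j)).

(* Of the xi qubits of each region the first kappa are logical and the others *)
(* are ancillas; the logical qubits are numbered from left to right.          *)
Definition logical_part (n k xi kappa : nat) (s : qubits n) : qubits k :=
  [ffun a : 'I_k => bit s (a %/ kappa * xi + a %% kappa)].

Definition ancillas_zero (n xi kappa : nat) (s : qubits n) : bool :=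
  [forall q : 'I_n, (kappa <= q %% xi)%N ==> ~~ s q].

(* rho (x) |0^(n-k)><0^(n-k)| *)
Definition with_ancillas (n k xi : nat) (rho : endo R (qubits k)) :
    endo R (qubits n) :=
  let kappa := (k * xi %/ n)%N in
  opmx (fun s t : qubits n =>
    if ancillas_zero xi kappa s && ancillas_zero xi kappa t
    then coef rho (logical_part k xi kappa s) (logical_part k xi kappa t)
    else 0).

Definition encoding (n k xi : nat) (U : endo R (qubits n))
    (rho : endo R (qubits k)) : endo R (qubits n) :=
  U *m with_ancillas n xi rho *m U^t*.

Definition region_size (n : nat) (eps : R) : nat :=
  Num.truncn (log2 (n%:R / eps)).

(* The expectation of the Choi error over independent uniformly random        *)
(* Cliffords. The phase chosen by clifford_mx is irrelevant since the gates   *)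
(* only enter through rho |-> U rho U^*.                                      *)
Definition expected_choi_error (p : 'I_4 -> R) (n k : nat) (eps : R) : R :=
  let xi := region_size n eps in
  (\sum_(g : {ffun 'I_(n %/ xi).-1 -> clifford_class R (2 * xi)})
     choi_error (pauli_noise p
       \o @encoding n k xi (blocked_circuit (fun j => clifford_mx (g j)))))
  / #|{: {ffun 'I_(n %/ xi).-1 -> clifford_class R (2 * xi)}}|%:R.

(* The integrality requirements: xi = log2 (n / eps) is an integer, n = 2 N xi *)
(* with N >= 1, and each region has (k / n) xi logical qubits.                 *)
Definition admissible (n k : nat) (eps : R) : Prop :=
  [/\ (0 < n)%N, (k <= n)%N, 0 < eps, (0 < region_size n eps)%N &
   [/\ (region_size n eps)%:R = log2 (n%:R / eps),
       (2 * region_size n eps %| n)%N &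
       (n %| k * region_size n eps)%N]].

End DoubleLayerBlocked.

(* Main.v *)
Require Import Defs.
From HB Require Import structures.
From mathcomp Require Import all_boot all_order all_algebra.
From mathcomp Require Import all_classical all_reals all_analysis.
From mathcomp Require Import complex ring lra zify.
Import Order.TTheory GRing.Theory Num.Theory.
Import numFieldNormedType.Exports.

(* Conjugation by the circuit U permutes Pauli strings up to phases, so a       *)
(* decoder may measure the ancilla X-parts of the pulled-back error (its        *)
(* syndrome) and undo the unique typical error with that syndrome. Since        *)
(* F(phi, sigma)^2 >= tr(phi sigma), the Choi error is at most the square root  *)
(* of the probability that the error is atypical or shares its syndrome with    *)
(* another typical error. A random Clifford maps a non-identity string to a     *)
(* uniform non-identity one; pulling a string F back through both layers shows  *)
(* that F has trivial syndrome with probability at most the product, over the   *)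
(* regions where F is non-identity, of 4 * 2^-(number of ancillas per region).  *)
(* Typicality is imposed region by region: as log n / xi -> 0, a Chernoff bound *)
(* makes all n / xi regions typical, and the union bound over typical errors    *)
(* then factorizes over regions. The failure probability tends to 0, which is   *)
(* more than enough for the term 8 delta.                                       *)

Set Implicit Arguments.
Unset Strict Implicit.
Unset Printing Implicit Defensive.
Local Open Scope classical_set_scope.
Local Open Scope sesquilinear_scope.
Local Open Scope complex_scope.
Local Open Scope ring_scope.

(** * Pauli strings *)

(** For a fixed circuit everything is combinatorics of strings. [choi_error_le] bounds the Choi
    error by entanglement fidelity: a pair (noise operator, decoder operator) whose product is a
    phase times the identity contributes its full probability. Hence [choi_error_correctable]: the
    error is at most the square root of the probability of the strings that are not [correctable],
    that is, atypical or sharing their syndrome with another typical string.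

    Pulling back through the circuit is a homomorphism on strings ([conjugates_pmul]), so v and w
    collide only if the pull-back of their product F has no X-part on the ancillas. Cliffords act
    transitively on non-identity strings ([conjugate_pauli]), so a random one makes such a string
    uniform ([card_pull], [pull_average]). With t = 2^-(ancillas per region), the first layer makes
    the ancilla condition cost at most t per non-identity region of its input ([even_layer_bound]),
    and the second layer turns that into 4t per non-identity region of F ([odd_layer_bound]);
    together they give [circuit_bound].

    Let T0 be the typical strings of one region and c = n / xi the number of regions.
    [average_failure] bounds the mean failure probability by c Pr[not T0] + (1 + 4 t |T0|)^c - 1. If
    k/n <= 1 - h - 2d, then |T0| <= 2^(xi (h + d)) and t <= 2^(-xi (h + 2d)), while [chernoff]
    bounds Pr[not T0] by q^xi with q < 1. Both terms are thus governed by n times an exponentially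
    small function of xi ([failure_bound_le]), which is O(1/n) since log n = o(xi); this is
    [expected_eventually], from which both claims follow. *)

Notation pstring n := {ffun 'I_n -> 'I_4}.

(** Letters are coded by an X-bit and a Z-bit, Y having both. Up to phase, multiplication becomes
    addition over F_2 and anticommutation the symplectic form [anticomm1]. *)
Definition xbit (w : 'I_4) : bool := (w == 1%N :> nat) || (w == 2%N :> nat).
Definition zbit (w : 'I_4) : bool := (w == 2%N :> nat) || (w == 3%N :> nat).
Definition of_xz (x z : bool) : 'I_4 :=
  if x then (if z then @Ordinal 4 2 isT else @Ordinal 4 1 isT)
  else (if z then @Ordinal 4 3 isT else ord0).

Definition pmul1 (a b : 'I_4) : 'I_4 :=
  of_xz (xbit a (+) xbit b) (zbit a (+) zbit b).

Definition anticomm1 (a b : 'I_4) : bool := (xbit a && zbit b) (+) (zbit a && xbit b).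

(* XY = iZ, YZ = iX, ZX = iY. *)
Definition phase1 (a b : 'I_4) : nat :=
  if anticomm1 a b then (if b == (a %% 3).+1 :> nat then 1 else 3) else 0.

Lemma xbit_of_xz x z : xbit (of_xz x z) = x. Proof. by case: x z => [] []. Qed.
Lemma zbit_of_xz x z : zbit (of_xz x z) = z. Proof. by case: x z => [] []. Qed.

Lemma of_xzK w : of_xz (xbit w) (zbit w) = w.
Proof. by case: w => [[|[|[|[|//]]]] hw] /=; apply: val_inj. Qed.

Definition pmul n (w v : pstring n) : pstring n := [ffun q => pmul1 (w q) (v q)].
Definition pone {n} : pstring n := [ffun=> ord0].

Lemma pmul1xx a : pmul1 a a = ord0.
Proof. by rewrite /pmul1 !addbb. Qed.

Lemma pmul1A : associative pmul1.
Proof. by move=> a b c; rewrite /pmul1 !xbit_of_xz !zbit_of_xz !addbA. Qed.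

Lemma pmul1C : commutative pmul1.
Proof. by move=> a b; rewrite /pmul1 addbC [zbit a (+) _]addbC. Qed.

Lemma pmul1_id a : pmul1 ord0 a = a.
Proof. by rewrite /pmul1 !addFb of_xzK. Qed.

Lemma pmul1K a b : pmul1 a (pmul1 a b) = b.
Proof. by rewrite pmul1A pmul1xx pmul1_id. Qed.

Lemma pmulK n (a b : pstring n) : pmul a (pmul a b) = b.
Proof. by apply/ffunP => q; rewrite !ffunE pmul1K. Qed.

Lemma pmulww n (a : pstring n) : pmul a a = pone.
Proof. by apply/ffunP => q; rewrite !ffunE pmul1xx. Qed.

Lemma pmulC n (a b : pstring n) : pmul a b = pmul b a.
Proof. by apply/ffunP => q; rewrite !ffunE pmul1C. Qed.

Lemma pmulw1 n (a : pstring n) : pmul a pone = a.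
Proof. by apply/ffunP => q; rewrite !ffunE pmul1C pmul1_id. Qed.

Lemma pmul_eq1 n (a b : pstring n) : (pmul a b == pone) = (a == b).
Proof.
apply/eqP/eqP => [h|->]; last exact: pmulww.
by rewrite -[b](pmulK a) h pmulw1.
Qed.

Section Paulis.
Variable R : realType.
Local Notation C := R[i].

Lemma coef_adj (S T : finType) (A : 'M[C]_(#|{: S}|, #|{: T}|)) s t :
  A^t* (enum_rank t) (enum_rank s) = (A (enum_rank s) (enum_rank t))^*%R.
Proof. by rewrite !mxE. Qed.

Lemma coef_adjE (T : finType) (A : endo R T) s t :
  coef (A^t*) s t = (coef A t s)^*%R.
Proof. exact: coef_adj. Qed.

Lemma coef_mul (S T Q : finType) (A : 'M[C]_(#|{: S}|, #|{: T}|))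
    (B : 'M[C]_(#|{: T}|, #|{: Q}|)) s t :
  (A *m B) (enum_rank s) (enum_rank t) =
  \sum_u A (enum_rank s) (enum_rank u) * B (enum_rank u) (enum_rank t).
Proof.
rewrite mxE (reindex enum_rank) //=.
by apply: onW_bij; exact: enum_rank_bij.
Qed.

Lemma pauli1_mul (a b : 'I_4) :
  pauli1 R a *m pauli1 R b = 'i%C ^+ phase1 a b *: pauli1 R (pmul1 a b).
Proof.
have ii : 'i%C * 'i%C = -1 :> C by rewrite -expr2 sqr_i.
have i3 : 'i%C ^+ 3 = - 'i%C :> C by rewrite exprS sqr_i mulrN1.
apply: coef_inj => s t; rewrite Defs.coefM coef_scale big_bool !coef_opmx.
case: a b s t => [[|[|[|[|//]]]] ha] [[|[|[|[|//]]]] hb] [] [] /=;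
rewrite /phase1 /pmul1 /anticomm1 /= ?modnn /= ?i3 ?expr0 ?expr1;
rewrite ?(mul0r, mulr0, mulr1, mul1r, addr0, add0r, mulrN1, mulN1r, mulrN, mulNr, ii, opprK) //.
Qed.

Lemma conjC_i : ('i%C : C)^*%R = - 'i%C.
Proof. by apply/eqP; rewrite eq_complex /= oppr0 !eqxx. Qed.

Lemma pauli1_adj (a : 'I_4) : (pauli1 R a)^t* = pauli1 R a.
Proof.
apply: coef_inj => s t; rewrite coef_adjE !coef_opmx.
case: a s t => [[|[|[|[|//]]]] ha] [] [] /=;
by rewrite ?expr0 ?expr1 ?rmorphN /= ?rmorph0 ?rmorph1 ?conjC_i ?opprK.
Qed.

Lemma pauli1_1 : pauli1 R ord0 = 1%:M.
Proof. by apply: coef_inj => s t; rewrite coef_scalar coef_opmx /= -mulr_natr mul1r. Qed.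

Lemma coef_pauli n (w : pstring n) s t :
  coef (pauli R w) s t = \prod_q coef (pauli1 R (w q)) (s q) (t q).
Proof. by rewrite coef_opmx. Qed.

Lemma pauli_adj n (w : pstring n) : (pauli R w)^t* = pauli R w.
Proof.
apply: coef_inj => s t; rewrite coef_adjE !coef_pauli.
rewrite rmorph_prod; apply: eq_bigr => q _.
by rewrite -[in RHS]pauli1_adj coef_adjE.
Qed.

Lemma pauli_mul n (w v : pstring n) :
  pauli R w *m pauli R v =
  'i%C ^+ (\sum_q phase1 (w q) (v q)) *: pauli R (pmul w v).
Proof.
apply: coef_inj => s t; rewrite Defs.coefM coef_scale coef_pauli.
transitivity (\sum_(u : qubits n) \prod_q (coef (pauli1 R (w q)) (s q) (u q) *
    coef (pauli1 R (v q)) (u q) (t q))).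
  by apply: eq_bigr => u _; rewrite !coef_pauli -big_split.
rewrite -(bigA_distr_bigA (fun q b => coef (pauli1 R (w q)) (s q) b *
  coef (pauli1 R (v q)) b (t q))) -prodrXr -big_split /=.
by apply: eq_bigr => q _; rewrite -Defs.coefM pauli1_mul coef_scale ffunE.
Qed.

Lemma pauli_pone n : pauli R (@pone n) = 1%:M.
Proof.
apply: coef_inj => s t; rewrite coef_pauli coef_scalar.
under eq_bigr => q _ do rewrite ffunE pauli1_1 coef_scalar.
case: eqP => [->|/eqP st]; first by rewrite big1 // => q _; rewrite eqxx.
have [q hq] : exists q, s q != t q.
  by apply/existsP; apply: contraR st => /existsPn h; apply/eqP/ffunP => q;
     have := h q; rewrite negbK => /eqP.
by rewrite (bigD1 q) //= (negbTE hq) mul0r.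
Qed.

Lemma pauli_sqr n (w : pstring n) : pauli R w *m pauli R w = 1%:M.
Proof.
rewrite pauli_mul pmulww pauli_pone big1 ?expr0 ?scale1r // => q _.
by rewrite /phase1 /anticomm1 andbC addbb.
Qed.

(** Freezing every qubit but q at an entry where [w] is nonzero (row false, column [fl]) leaves a
    proportionality between the one-qubit Paulis at q. The scalar is arbitrary, so phases never have
    to be tracked. *)
Lemma pauli_prop_inj n (w v : pstring n) (c : C) :
  pauli R w = c *: pauli R v -> w = v.
Proof.
move=> h.
pose fl (a : 'I_4) := xbit a.
have nz a : coef (pauli1 R a) false (fl a) != 0.
  have i0 : 'i%C != 0 :> C by rewrite eq_complex /= oner_eq0 andbF.
  by rewrite coef_opmx; case: a => [[|[|[|[|//]]]] ha] //=;
     rewrite ?expr0 ?oner_eq0 ?oppr_eq0.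
apply/ffunP => q.
pose K := \prod_(r | r != q) coef (pauli1 R (w r)) false (fl (w r)).
pose K' := \prod_(r | r != q) coef (pauli1 R (v r)) false (fl (w r)).
have K0 : K != 0 by rewrite prodf_seq_neq0; apply/allP => r _; apply/implyP.
apply: (@pauli1_prop_inj R _ _ (K^-1 * (c * K'))) => a b.
have := congr1 (fun A => coef A [ffun r => if r == q then a else false]
  [ffun r => if r == q then b else fl (w r)]) h.
rewrite coef_scale !coef_pauli (bigD1 q) //= [in RHS](bigD1 q) //= !ffunE eqxx.
rewrite (eq_bigr (fun r => coef (pauli1 R (w r)) false (fl (w r)))); last first.
  by move=> r rq; rewrite !ffunE (negbTE rq).
rewrite [in RHS](eq_bigr (fun r => coef (pauli1 R (v r)) false (fl (w r)))); last first.
  by move=> r rq; rewrite !ffunE (negbTE rq).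
rewrite -/K -/K' => e; apply: (mulfI K0).
by rewrite mulrC e !mulrA mulfV // mul1r -!mulrA [K' * _]mulrC.
Qed.

Lemma phase1C a b : 'i%C ^+ phase1 a b = (-1) ^+ anticomm1 a b * 'i%C ^+ phase1 b a :> C.
Proof.
have i3 : 'i%C ^+ 3 = - 'i%C :> C by rewrite exprS sqr_i mulrN1.
case: a => [[|[|[|[|?]]]] ha]; case: b => [[|[|[|[|?]]]] hb] //;
rewrite /phase1 /anticomm1 /= ?modnn /= ?i3 ?expr0 ?expr1 ?mulN1r ?opprK ?mul1r //.
Qed.

Definition anticomm n (w v : pstring n) : nat := (\sum_q anticomm1 (w q) (v q))%N.

Lemma pauli_comm n (w v : pstring n) :
  pauli R w *m pauli R v = (-1) ^+ anticomm w v *: (pauli R v *m pauli R w).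
Proof.
rewrite !pauli_mul scalerA pmulC -!prodrXr -big_split /=; congr (_ *: _).
by apply: eq_bigr => q _; rewrite phase1C.
Qed.

End Paulis.

(** * Random Cliffords *)

Lemma mulmx_adj (C : numClosedFieldType) (m n p : nat) (A : 'M[C]_(m, n)) (B : 'M[C]_(n, p)) :
  (A *m B)^t* = B^t* *m A^t*.
Proof. by rewrite trmx_mul map_mxM. Qed.

Section Clifford.
Variable R : realType.
Local Notation C := R[i].

Lemma adjZ (m n : nat) (c : C) (A : 'M[C]_(m, n)) : (c *: A)^t* = c^*%R *: A^t*.
Proof. by rewrite linearZ /= map_mxZ. Qed.

Lemma unitary_adjM (n : nat) (U : 'M[C]_n) :
  U \is unitarymx -> U *m U^t* = 1%:M /\ U^t* *m U = 1%:M.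
Proof. by move=> /unitarymxP h; split=> //; exact: mulmx1C. Qed.

(** Only the map on strings matters for syndromes and corrections; of the phase, the fidelity sees
    just the modulus. *)
Definition conjugates n (V : endo R (qubits n)) (f : pstring n -> pstring n) :=
  forall w, exists2 c : C, `|c| = 1 &
    V *m pauli R w *m V^t* = c *: pauli R (f w).

Lemma norm_i : `|'i%C : C| = 1.
Proof.
by rewrite normc_def /= expr0n expr1n add0r sqrtr1.
Qed.

Lemma norm_phase k : `|'i%C ^+ k : C| = 1.
Proof. by rewrite normrX norm_i expr1n. Qed.

Lemma phase_neq0 k : 'i%C ^+ k != 0 :> C.
Proof. by rewrite -normr_eq0 norm_phase oner_eq0. Qed.

(** Conjugation is multiplicative on operators, and [pauli_prop_inj] cancels the phases: f is linear
    over F_2. *)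
Lemma conjugates_pmul n (V : endo R (qubits n)) f :
  V \is unitarymx -> conjugates V f ->
  forall a b, f (pmul a b) = pmul (f a) (f b).
Proof.
move=> /unitary_adjM [V1 V2] hf a b.
have [c c1 hc] := hf (pmul a b); have [d d1 hd] := hf a; have [e e1 he] := hf b.
have cn0 : c != 0 by rewrite -normr_eq0 c1 oner_eq0.
set ph := 'i%C ^+ (\sum_q phase1 (f a q) (f b q)) : C.
have E : V *m (pauli R a *m pauli R b) *m V^t* =
    (d * e * ph) *: pauli R (pmul (f a) (f b)).
  have -> : V *m (pauli R a *m pauli R b) *m V^t* =
     (V *m pauli R a *m V^t*) *m (V *m pauli R b *m V^t*).
    by rewrite !mulmxA -(mulmxA (V *m pauli R a) (V^t*) V) V2 mulmx1.
  by rewrite hd he -scalemxAl -scalemxAr pauli_mul !scalerA.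
rewrite pauli_mul -scalemxAr -scalemxAl hc scalerA in E.
have n0 : d * e * ph != 0.
  by rewrite -normr_eq0 !normrM d1 e1 norm_phase !mulr1 oner_eq0.
apply/esym; apply: (@pauli_prop_inj R _ _ _ ((d * e * ph)^-1 *
   ('i%C ^+ (\sum_q phase1 (a q) (b q)) * c))).
by apply: (scalerI n0); rewrite -E scalerA mulrA divff // mul1r.
Qed.

Lemma conjugates_inj n (V : endo R (qubits n)) f :
  V \is unitarymx -> conjugates V f -> injective f.
Proof.
move=> /unitary_adjM [V1 V2] hf a b fab.
have [c c1 hc] := hf a; have [d d1 hd] := hf b.
have back A B : V *m A *m V^t* = B -> A = V^t* *m B *m V.
  by move=> <-; rewrite !mulmxA V2 mul1mx -mulmxA V2 mulmx1.
have dn0 : d != 0 by rewrite -normr_eq0 d1 oner_eq0.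
apply: (@pauli_prop_inj R _ _ _ (c * d^-1)).
rewrite (back _ _ hc) (back _ _ hd) fab -!scalemxAr -!scalemxAl scalerA.
by rewrite divfK.
Qed.

Lemma conjugates_pone n (V : endo R (qubits n)) f :
  V \is unitarymx -> conjugates V f -> f pone = pone.
Proof.
move=> uV hf; apply: (can_inj (pmulK (f pone))).
by rewrite -(conjugates_pmul uV hf) !pmulw1.
Qed.

Section OneGate.
Variable m : nat.
Implicit Types g : clifford_class R m.

Lemma clifford_mxP g :
  clifford (clifford_mx g) /\ conj_action (clifford_mx g) (val g).
Proof.
have /asboolP [U cU aU] := valP g.
by rewrite /clifford_mx; case: xgetP => [V _ //|/(_ U)]; case.
Qed.

Lemma clifford_mx_unitary g : clifford_mx g \is unitarymx.
Proof. by case: (clifford_mxP g) => -[]. Qed.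

Definition clifford_push g (w : pstring m) : pstring m := (val g w).2.

Lemma push_conjugates g : conjugates (clifford_mx g) (clifford_push g).
Proof.
move=> w; exists ('i%C ^+ (val g w).1); first exact: norm_phase.
by case: (clifford_mxP g) => _ /(_ w).
Qed.

Lemma push_inj g : injective (clifford_push g).
Proof. exact: conjugates_inj (clifford_mx_unitary g) (push_conjugates g). Qed.

(** Conjugation by the adjoint, the direction in which a physical error is carried back to the input
    of the gate. *)
Definition clifford_pull g : pstring m -> pstring m := invF (@push_inj g).

Lemma push_pull g : cancel (clifford_pull g) (clifford_push g).
Proof. exact: f_invF. Qed.

Lemma pull_conjugates g : conjugates ((clifford_mx g)^t*) (clifford_pull g).
Proof.
move=> w; have [c c1] := push_conjugates g (clifford_pull g w).
rewrite push_pull => h.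
have [V1 V2] := unitary_adjM (clifford_mx_unitary g).
have cn0 : c != 0 by rewrite -normr_eq0 c1 oner_eq0.
exists c^-1; first by rewrite normfV c1 invr1.
rewrite trmxCK; apply: (scalerI cn0).
rewrite scalerA divff // scale1r scalemxAl scalemxAr -h.
by rewrite !mulmxA V2 mul1mx -mulmxA V2 mulmx1.
Qed.

Lemma adj_clifford_unitary g : (clifford_mx g)^t* \is unitarymx.
Proof. by rewrite trmxC_unitary clifford_mx_unitary. Qed.

Lemma pull_pone g : clifford_pull g pone = pone.
Proof. exact: conjugates_pone (adj_clifford_unitary g) (pull_conjugates g). Qed.

Lemma expi_mod k : 'i%C ^+ (k %% 4) = 'i%C ^+ k :> C.
Proof.
rewrite {2}(divn_eq k 4) exprD mulnC exprM.
by rewrite (_ : 'i%C ^+ 4 = 1) ?expr1n ?mul1r // (exprM _ 2 2) sqr_i sqrrN expr1n.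
Qed.

Lemma pauli_groupI k (w : pstring m) : pauli_group ('i%C ^+ k *: pauli R w).
Proof.
have hk : (k %% 4 < 4)%N by rewrite ltn_pmod.
by exists (Ordinal hk), w; rewrite /= expi_mod.
Qed.

(* The unitary exp(i pi/4 P) for a Pauli string P, which acts on Pauli strings *)
(* as a symplectic transvection.                                               *)
Definition transvection (u : pstring m) : endo R (qubits m) :=
  (sqrtC 2)^-1 *: (1%:M + 'i%C *: pauli R u).

(** With X = 1 + iP and Y = 1 - iP one has XY = 2 and XX = 2iP. Moving Q to the left past Y turns Y
    into X if P and Q anticommute and leaves it unchanged otherwise, so XQY is XXQ or XYQ. *)
Lemma transvection_conj u v :
  transvection u *m pauli R v *m (transvection u)^t* =
  if odd (anticomm u v) then 'i%C *: (pauli R u *m pauli R v) else pauli R v.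
Proof.
set s : C := (sqrtC 2)^-1; set P := pauli R u; set Q := pauli R v.
have ss : s * s = 2^-1 by rewrite -invfM -expr2 sqrtCK.
have sR : s^*%R = s.
  by rewrite /s; apply/CrealP; rewrite rpredV; apply: ger0_real; rewrite sqrtC_ge0 ler0n.
have ii : 'i%C * 'i%C = -1 :> C by rewrite -expr2 sqr_i.
have two : (2 : C) != 0 by rewrite pnatr_eq0.
have PP : P *m P = 1%:M := pauli_sqr R u.
pose X := 1%:M + 'i%C *: P; pose Y := 1%:M - 'i%C *: P.
have adjT : (transvection u)^t* = s *: Y.
  rewrite adjZ sR /Y linearD /= map_mxD trmx1 map_mx1 adjZ pauli_adj.
  by rewrite conjC_i scaleNr.
have XY : X *m Y = 2 *: 1%:M.
  rewrite /X /Y mulmxDl !mulmxBr !mul1mx !mulmx1 -scalemxAl -scalemxAr scalerA.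
  rewrite ii PP scaleN1r opprK addrA subrK.
  by rewrite scaler_nat mulr2n.
have XX : X *m X = 2 *: ('i%C *: P).
  rewrite /X mulmxDl !mulmxDr !mul1mx !mulmx1 -!scalemxAl -!scalemxAr [in LHS]scalerA.
  rewrite ii PP scaleN1r addrC addrA subrK.
  by rewrite -mulr2n scaler_nat.
have PQ : P *m Q = (-1) ^+ odd (anticomm u v) *: (Q *m P).
  by rewrite signr_odd; exact: pauli_comm.
have QY : Q *m Y = if odd (anticomm u v) then X *m Q else Y *m Q.
  move: PQ; case: odd => PQ; rewrite /X /Y mulmxBr ?mulmxBl ?mulmxDl;
    rewrite mul1mx mulmx1 -scalemxAr -scalemxAl PQ.
    by rewrite expr1 scaleN1r scalerN.
  by rewrite expr0 scale1r.
have E : transvection u *m Q *m (transvection u)^t* = 2^-1 *: (X *m (Q *m Y)).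
  by rewrite adjT /transvection -/X -!scalemxAl -scalemxAr scalerA ss mulmxA.
rewrite E QY; apply: (scalerI two); rewrite scalerA divff // scale1r.
clearbody X Y P Q; move: XX XY {E QY PQ adjT PP}.
case: odd => XX XY; first by rewrite mulmxA XX -!scalemxAl.
by rewrite mulmxA XY -scalemxAl mul1mx.
Qed.

Lemma transvection_clifford u : clifford (transvection u).
Proof.
split.
  apply/unitarymxP; have := transvection_conj u pone.
  rewrite pauli_pone mulmx1 ifF // /anticomm big1 // => q _.
  by rewrite ffunE /anticomm1 /= !andbF.
move=> _ [a [w ->]]; rewrite -scalemxAr -scalemxAl transvection_conj.
case: odd; last exact: pauli_groupI.
by rewrite scalerA -exprSr pauli_mul scalerA -exprD; exact: pauli_groupI.
Qed.

Lemma cliffordM (U V : endo R (qubits m)) :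
  clifford U -> clifford V -> clifford (U *m V).
Proof.
move=> [uU hU] [uV hV]; split; first exact: mul_unitarymx.
move=> P /hV /hU; by rewrite mulmx_adj !mulmxA.
Qed.

Definition conjugate (w v : pstring m) :=
  exists h, clifford h /\ exists c : C, h *m pauli R w *m h^t* = c *: pauli R v.

Lemma conjugate_trans w u v : conjugate w u -> conjugate u v -> conjugate w v.
Proof.
move=> [h [ch [c hc]]] [k [ck [d hd]]]; exists (k *m h).
split; first exact: cliffordM.
exists (c * d); rewrite mulmx_adj.
rewrite -scalerA -hd scalemxAl scalemxAr -hc.
by rewrite !mulmxA.
Qed.

Lemma anticommM (u v : pstring m) :
  odd (anticomm (pmul u v) u) = odd (anticomm v u).
Proof.
have h (F : 'I_m -> bool) : odd (\sum_q F q) = \big[addb/false]_q F q.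
  by rewrite (big_morph odd oddD (erefl _)); apply: eq_bigr => q _; rewrite oddb.
rewrite /anticomm !h; apply: eq_bigr => q _.
rewrite !ffunE /anticomm1 /pmul1 xbit_of_xz zbit_of_xz.
by case: (xbit (u q)) (zbit (u q)) (xbit (v q)) (zbit (v q)) => [] [] [] [].
Qed.

(** The product wv anticommutes with w, so its transvection sends w to (wv)w, which is v up to
    phase. *)
Lemma conjugate_anticomm w v : odd (anticomm w v) -> conjugate w v.
Proof.
move=> hwv; exists (transvection (pmul w v)); split; first exact: transvection_clifford.
have hs : odd (anticomm v w).
  rewrite (_ : anticomm v w = anticomm w v) // /anticomm; apply: eq_bigr => q _.
  by rewrite /anticomm1 addbC andbC [X in _ (+) X]andbC.
rewrite transvection_conj ifT; last first.
  by rewrite anticommM.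
rewrite pauli_mul scalerA [pmul (pmul w v) w]pmulC pmulK.
by eexists.
Qed.

Definition single (q : 'I_m) (a : 'I_4) : pstring m :=
  [ffun r => if r == q then a else ord0].

Lemma anticomm_single (w : pstring m) q a : anticomm w (single q a) = anticomm1 (w q) a.
Proof.
rewrite /anticomm (bigD1 q) //= ffunE eqxx big1 ?addn0 // => r rq.
by rewrite ffunE (negbTE rq) /anticomm1 /= !andbF.
Qed.

Lemma anticomm_pmul (w u v : pstring m) :
  odd (anticomm w (pmul u v)) = odd (anticomm w u) (+) odd (anticomm w v).
Proof.
have h (F : 'I_m -> bool) : odd (\sum_q F q) = \big[addb/false]_q F q.
  by rewrite (big_morph odd oddD (erefl _)); apply: eq_bigr => q _; rewrite oddb.
rewrite /anticomm !h -big_split /=; apply: eq_bigr => q _.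
rewrite !ffunE /anticomm1 /pmul1 xbit_of_xz zbit_of_xz.
by case: (xbit (u q)) (zbit (u q)) (xbit (v q)) (zbit (v q))
  (xbit (w q)) (zbit (w q)) => [] [] [] [] [] [].
Qed.

Lemma anticomm1_ex (a b : 'I_4) : a != ord0 -> b != ord0 ->
  exists c, anticomm1 a c && anticomm1 b c.
Proof.
(* Distinct non-identity letters anticommute, so their product anticommutes with both; for equal
   letters any other non-identity letter will do. *)
move=> a0 b0; exists (if a == b then (if zbit a then of_xz true (~~ xbit a) else of_xz false true) else pmul1 a b).
by case: a b a0 b0 => [[|[|[|[|?]]]] ha] [[|[|[|[|?]]]] hb].
Qed.

(** It suffices to pass through a string u anticommuting with both. A single letter does if the
    supports meet; otherwise u has one letter in the support of each. *)
Lemma conjugate_pauli w v : w != pone -> v != pone -> conjugate w v.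
Proof.
have neq (u : pstring m) : u != pone -> exists q, u q != ord0.
  move=> h; apply/existsP; apply: contraR h => /existsPn h; apply/eqP/ffunP => q.
  by have := h q; rewrite negbK ffunE => /eqP.
move=> w0 v0.
suff [u hu] : exists u, odd (anticomm w u) && odd (anticomm v u).
  have /andP [h1 h2] := hu; apply: (@conjugate_trans _ u); first exact: conjugate_anticomm.
  apply: conjugate_anticomm; move: h2; congr odd; apply: eq_bigr => q _.
  by rewrite /anticomm1 addbC andbC [X in _ (+) X]andbC.
have [q wq] := neq _ w0; have [r vr] := neq _ v0.
have [vq|vq] := eqVneq (v q) ord0; last first.
  have [c hc] := anticomm1_ex wq vq; exists (single q c).
  by rewrite !anticomm_single !oddb.
have [wr|wr] := eqVneq (w r) ord0; last first.
  have [c hc] := anticomm1_ex wr vr; exists (single r c).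
  by rewrite !anticomm_single !oddb.
have [c /andP[hc _]] := anticomm1_ex wq wq.
have [d /andP[hd _]] := anticomm1_ex vr vr.
exists (pmul (single q c) (single r d)).
by rewrite !anticomm_pmul !anticomm_single !oddb hc hd vq wr /anticomm1 /=.
Qed.

(** Right multiplication by a Clifford h carrying v' to v permutes the classes and matches the two
    sets. Representatives are fixed only up to phase, so injectivity is checked through
    [eq_conj_action]. *)
Lemma card_pull w v v' : v != pone -> v' != pone ->
  #|[set g | clifford_pull g w == v]%SET| = #|[set g | clifford_pull g w == v']%SET|.
Proof.
move=> v0 v'0; have [h [ch [c hc]]] := conjugate_pauli v'0 v0.
have uh : h \is unitarymx by case: ch.
have [h1 h2] := unitary_adjM uh.
have ex g : exists g', conj_action (clifford_mx g *m h) (val g').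
  have cl : clifford (clifford_mx g *m h).
    exact: cliffordM (proj1 (clifford_mxP g)) ch.
  have [tau ht] := clifford_has_action cl.
  have pt : `[< exists2 U : endo R (qubits m), clifford U & conj_action U tau >].
    by apply: asboolT; exists (clifford_mx g *m h).
  by exists (exist _ tau pt).
have [rm hrm] := choice ex.
have uM g : clifford_mx g *m h \is unitarymx.
  exact: mul_unitarymx (clifford_mx_unitary g) uh.
have rm_inj : injective rm.
  move=> g g' e; have a' := hrm g'; rewrite -e in a'.
  have [d d1 E] := (eq_conj_action (uM g) (uM g') (hrm g)).1 a'.
  have E' : clifford_mx g' = d *: clifford_mx g.
    have := congr1 (fun A => A *m h^t*) E.
    by rewrite /= -scalemxAl -!mulmxA h1 !mulmx1.
  apply: val_inj; refine (conj_action_inj (proj2 (clifford_mxP g)) _).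
  apply: (proj2 (eq_conj_action (clifford_mx_unitary g') (clifford_mx_unitary g)
    (proj2 (clifford_mxP g')))).
  have d0 : d != 0 by rewrite -normr_eq0 d1 oner_eq0.
  exists d^-1; first by rewrite normfV d1 invr1.
  by rewrite E' scalerA mulVf // scale1r.
have key g : (clifford_pull (rm g) w == v') = (clifford_pull g w == v).
  rewrite -(inj_eq (@push_inj (rm g))) push_pull.
  rewrite -[in RHS](inj_eq (@push_inj g)) push_pull.
  suff -> : clifford_push (rm g) v' = clifford_push g v by [].
  have := hrm g v'; rewrite mulmx_adj !mulmxA.
  rewrite -2!(mulmxA (clifford_mx g)) hc.
  rewrite -scalemxAr -scalemxAl (clifford_mxP g).2 scalerA => E.
  apply: (@pauli_prop_inj R _ _ _ (('i%C ^+ (val (rm g) v').1)^-1 * (c * 'i%C ^+ (val g v).1))).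
  by rewrite -scalerA E scalerA mulVf ?phase_neq0 // scale1r.
rewrite -(card_imset _ rm_inj); apply: eq_card => g.
have [k krm rmk] := injF_bij rm_inj.
rewrite inE; apply/imsetP/idP => [[g' hg' ->]|hg].
  by rewrite key; rewrite inE in hg'.
by exists (k g); rewrite ?rmk // inE -key rmk.
Qed.

End OneGate.
End Clifford.

Section CliffordAverage.
Variables (R : realType) (m : nat).

Lemma card_pstring : #|{: pstring m}| = (4 ^ m)%N.
Proof. by rewrite card_ffun !card_ord. Qed.

Lemma sum_nonid (c : R) :
  \sum_(v : pstring m | v != pone) c = ((4 ^ m)%:R - 1) * c.
Proof.
have E : \sum_(v : pstring m) c = (4 ^ m)%:R * c.
  by rewrite sumr_const card_pstring mulr_natl.
by rewrite mulrBl mul1r -E [in RHS](bigD1 pone) //= [RHS]addrC addKr.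
Qed.

(* The image of w is uniform among the non-identity strings; as f is maximal   *)
(* at the identity, including it can only increase the mean.                   *)
Lemma pull_average (f : pstring m -> R) w : w != pone ->
  (forall v, f v <= f pone) ->
  (4 ^ m)%:R * \sum_(g : clifford_class R m) f (clifford_pull g w) <=
    #|{: clifford_class R m}|%:R * \sum_v f v.
Proof.
move=> w0 f1; pose N := #|[set g : clifford_class R m | clifford_pull g w == w]%SET|.
have sum_pull (F : pstring m -> R) :
    \sum_(g : clifford_class R m) F (clifford_pull g w) = \sum_(v | v != pone) N%:R * F v.
  rewrite (partition_big (fun g => clifford_pull g w) (fun v => v != pone)) /=; last first.
    move=> g _; apply: contra w0 => /eqP h.
    by rewrite -(push_pull g w) h -{1}(pull_pone g) push_pull.
  apply: eq_bigr => v v0; rewrite (eq_bigr (fun=> F v)); last by move=> g /eqP ->.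
  rewrite sumr_const mulr_natl /N (card_pull R w w0 v0).
  by congr (_ *+ _); apply: eq_card => g; rewrite inE.
have tot : #|{: clifford_class R m}|%:R = ((4 ^ m)%:R - 1) * N%:R :> R.
  by rewrite -sum_nonid; under eq_bigr do rewrite -[N%:R]mulr1; rewrite -sum_pull sumr_const.
rewrite sum_pull tot [X in _ <= _ * X](bigD1 pone) //= -mulr_sumr.
set S := \sum_(v | v != pone) f v.
(* The claim reduces to 4^m S <= (4^m - 1)(f pone + S), that is, to this bound. *)
have S1 : S <= ((4 ^ m)%:R - 1) * f pone by rewrite -sum_nonid; exact: ler_sum.
rewrite mulrCA [leRHS]mulrAC [leRHS]mulrC.
by apply: ler_wpM2l => //; rewrite mulrDr mulrBl [X in _ <= _ + X]mulrBl; lra.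
Qed.

End CliffordAverage.

(** * Conjugation by the circuit *)

Section Windows.
Variables (T : Type) (x0 : T).

Definition win n (m o : nat) (f : {ffun 'I_n -> T}) : {ffun 'I_m -> T} :=
  [ffun a : 'I_m => oapp f x0 (insub (o + a)%N)].

Definition put n m (o : nat) (v : {ffun 'I_m -> T}) (f : {ffun 'I_n -> T}) :
    {ffun 'I_n -> T} :=
  [ffun q : 'I_n => if (o <= q)%N then oapp v (f q) (insub (q - o)%N) else f q].

Lemma winE n m o (f : {ffun 'I_n -> T}) (a : 'I_m) (h : (o + a < n)%N) :
  win m o f a = f (Ordinal h).
Proof. by rewrite ffunE insubT. Qed.

Lemma put_out n m o (v : {ffun 'I_m -> T}) (f : {ffun 'I_n -> T}) (q : 'I_n) :
  ~~ (o <= q < o + m)%N -> put o v f q = f q.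
Proof.
rewrite ffunE => h; case: ifP => // oq; rewrite insubF //; lia.
Qed.

Lemma put_in n m o (v : {ffun 'I_m -> T}) (f : {ffun 'I_n -> T}) (a : 'I_m)
  (q : 'I_n) : q = (o + a)%N :> nat -> put o v f q = v a.
Proof.
move=> e; rewrite ffunE e leq_addr addKn (insubT (fun i => (i < m)%N) (ltn_ord a)) /=.
by congr (v _); exact: val_inj.
Qed.

Lemma win_put n m o (v : {ffun 'I_m -> T}) (f : {ffun 'I_n -> T}) :
  (o + m <= n)%N -> win m o (put o v f) = v.
Proof.
move=> h; apply/ffunP => a.
have ha : (o + a < n)%N by rewrite (leq_trans _ h) // ltn_add2l.
by rewrite (winE _ ha) (@put_in _ _ _ _ _ a).
Qed.

Lemma win_put_disjoint n m o m' o' (v : {ffun 'I_m -> T}) (f : {ffun 'I_n -> T}) :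
  (o' + m' <= o)%N || (o + m <= o')%N -> win m' o' (put o v f) = win m' o' f.
Proof.
move=> h; apply/ffunP => a; rewrite !ffunE.
case: insubP => //= q _ e; rewrite put_out // e.
have la := ltn_ord a; lia.
Qed.

Lemma put_win n m o (f g : {ffun 'I_n -> T}) :
  (o + m <= n)%N ->
  (forall q : 'I_n, ~~ (o <= q < o + m)%N -> f q = g q) ->
  put o (win m o f) g = f.
Proof.
move=> h fg; apply/ffunP => q.
have [hq|hq] := boolP (o <= q < o + m)%N; last by rewrite put_out // fg.
have ha : (q - o < m)%N by lia.
have e : q = (o + Ordinal ha)%N :> nat by rewrite /=; lia.
rewrite (put_in _ _ e) winE; first by rewrite /=; lia.
by move=> ?; congr (f _); apply: val_inj.
Qed.

Lemma win_win n m o m' o' (f : {ffun 'I_n -> T}) :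
  (o' + m' <= m)%N -> win m' o' (win m o f) = win m' (o + o') f.
Proof.
move=> h; apply/ffunP => a; have la := ltn_ord a.
have ha : (o' + a < m)%N by lia.
by rewrite (winE _ ha) !ffunE /= addnA.
Qed.

End Windows.

Lemma big_window (A : Type) (idx : A) (op : Monoid.com_law idx) n m o
    (h : (o + m <= n)%N) (F : 'I_n -> A) (G : 'I_m -> A) :
  (forall (a : 'I_m) (q : 'I_n), q = (o + a)%N :> nat -> F q = G a) ->
  \big[op/idx]_(q < n | (o <= q < o + m)%N) F q = \big[op/idx]_(a < m) G a.
Proof.
move=> FG; have hs (a : 'I_m) : (o + a < n)%N by rewrite (leq_trans _ h) // ltn_add2l.
pose sh a := Ordinal (hs a).
have shI : injective sh by move=> a b /(congr1 val) /= /addnI; exact: val_inj.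
rewrite (eq_bigl (fun q => q \in [set sh a | a : 'I_m]%SET)); last first.
  move=> q; apply/idP/imsetP => [hq|[a _ ->]]; last first.
    by rewrite /= leq_addr ltn_add2l ltn_ord.
  have ha : (q - o < m)%N by lia.
  by exists (Ordinal ha) => //; apply: val_inj => /=; lia.
rewrite big_imset /=; last by move=> a b _ _; exact: shI.
by apply: eq_bigr => a _; exact: FG.
Qed.

(** * Gates acting on a window of qubits *)

Section Embedding.
Variable R : realType.
Local Notation C := R[i].

Section Hybrid.
Variables (n m o : nat).
Hypothesis hom : (o + m <= n)%N.

(** An operator A on the window tensored with the letters of w elsewhere. Embedded gates (w = 1) and
    Pauli strings (A a Pauli) are both of this form, and the form is stable under multiplication by
    embedded gates. *)
Definition hybrid (A : endo R (qubits m)) (w : pstring n) : endo R (qubits n) :=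
  opmx (fun s t : qubits n => coef A (window m o s) (window m o t) *
    \prod_(q < n | ~~ (o <= q < o + m)%N) coef (pauli1 R (w q)) (s q) (t q)).

Lemma coef_hybrid A w (s t : qubits n) : coef (hybrid A w) s t =
  coef A (window m o s) (window m o t) *
    \prod_(q < n | ~~ (o <= q < o + m)%N) coef (pauli1 R (w q)) (s q) (t q).
Proof. exact: coef_opmx. Qed.

Lemma windowE (s : qubits n) : window m o s = win false m o s.
Proof. by []. Qed.

Lemma pauli_hybrid (w : pstring n) : pauli R w = hybrid (pauli R (win ord0 m o w)) w.
Proof.
apply: coef_inj => s t; rewrite coef_hybrid !coef_pauli.
rewrite (bigID (fun q : 'I_n => (o <= q < o + m)%N)) /=; congr (_ * _).
apply: big_window => // a q e.
have hq : (o + a < n)%N by rewrite -e.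
rewrite !windowE !(winE _ _ hq).
by congr (coef (pauli1 R (w _)) (s _) (t _)); apply: val_inj.
Qed.

Lemma hybrid_put (v : pstring m) (w : pstring n) :
  hybrid (pauli R v) w = pauli R (put o v w).
Proof.
rewrite pauli_hybrid win_put //; apply: coef_inj => s t; rewrite !coef_hybrid.
by congr (_ * _); apply: eq_bigr => q hq; rewrite put_out.
Qed.

Lemma hybridZ c A w : hybrid (c *: A) w = c *: hybrid A w.
Proof. by apply: coef_inj => s t; rewrite coef_scale !coef_hybrid coef_scale mulrA. Qed.

Lemma embed_hybrid V : embed n o V = hybrid V pone.
Proof.
apply: coef_inj => s t; rewrite coef_hybrid coef_opmx.
under eq_bigr => q _ do rewrite ffunE pauli1_1 coef_scalar.
case: forallP => [h|h].
  rewrite big1 ?mulr1 // => q hq; have := h q; rewrite hq /= => /eqP ->.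
  by rewrite eqxx.
have [q] : exists q : 'I_n, ~~ (~~ (o <= q < o + m)%N ==> (s q == t q)).
  by apply/existsP; apply: contraT => /existsPn h'; case: h => q; have := h' q; rewrite negbK.
by rewrite negb_imply => /andP [hq st]; rewrite (bigD1 q) //= (negbTE st) mul0r mulr0.
Qed.

Lemma hybrid_adj A w : (hybrid A w)^t* = hybrid (A^t*) w.
Proof.
apply: coef_inj => s t; rewrite coef_adjE !coef_hybrid rmorphM rmorph_prod coef_adjE.
congr (_ * _); apply: eq_bigr => q _.
by rewrite -[in RHS]pauli1_adj coef_adjE.
Qed.

Lemma embed_adj (V : endo R (qubits m)) : (embed n o V)^t* = embed n o (V^t*).
Proof. by rewrite !embed_hybrid hybrid_adj. Qed.

(** A nonzero term needs an intermediate state that agrees with s off the window, so the sum runs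
    over the contents x of the window alone. *)
Lemma embed_mul_hybrid V A w : embed n o V *m hybrid A w = hybrid (V *m A) w.
Proof.
apply: coef_inj => s t; rewrite Defs.coefM.
pose agree (u : qubits n) := [forall q : 'I_n, ~~ (o <= q < o + m)%N ==> (s q == u q)].
pose G u := coef V (window m o s) (window m o u) * (coef A (window m o u) (window m o t) *
  \prod_(q < n | ~~ (o <= q < o + m)%N) coef (pauli1 R (w q)) (u q) (t q)).
transitivity (\sum_(u | agree u) G u).
  rewrite [RHS]big_mkcond /=; apply: eq_bigr => u _; rewrite coef_hybrid coef_opmx -/(agree u).
  by case: (agree u); rewrite ?mul0r.
rewrite (reindex_onto (fun x : qubits m => put o x s) (fun u => window m o u)) /=; last first.
  move=> u /forallP hu; rewrite windowE put_win // => q hq.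
  by have := hu q; rewrite hq => /eqP.
rewrite (eq_bigl predT) => [|x]; last first.
  rewrite windowE win_put // eqxx andbT; apply/forallP => q; apply/implyP => hq.
  by rewrite put_out.
rewrite coef_hybrid Defs.coefM mulr_suml; apply: eq_bigr => x _.
rewrite /G !(windowE (put _ _ _)) win_put // mulrA; congr (_ * _).
by apply: eq_bigr => q hq; rewrite put_out.
Qed.

Lemma hybrid_mul_embed V A w : hybrid A w *m embed n o V = hybrid (A *m V) w.
Proof.
rewrite -[LHS]trmxCK mulmx_adj hybrid_adj embed_adj embed_mul_hybrid hybrid_adj.
by rewrite mulmx_adj !trmxCK.
Qed.

Lemma embed_unitary (V : endo R (qubits m)) : V \is unitarymx -> embed n o V \is unitarymx.
Proof.
move=> /unitarymxP hV; apply/unitarymxP.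
rewrite embed_adj [embed n o (V^t*)]embed_hybrid embed_mul_hybrid hV.
rewrite -(pauli_pone R m) hybrid_put -(pauli_pone R n); congr pauli.
apply/ffunP => q; have [hq|hq] := boolP (o <= q < o + m)%N; last by rewrite put_out.
have ha : (q - o < m)%N by lia.
by rewrite (@put_in _ _ _ _ _ _ (Ordinal ha)) ?ffunE //=; lia.
Qed.

Lemma embed_conjugates (V : endo R (qubits m)) f : conjugates V f ->
  conjugates (embed n o V) (fun w => put o (f (win ord0 m o w)) w).
Proof.
move=> hV w; have [c c1 hc] := hV (win ord0 m o w); exists c => //.
rewrite {1}pauli_hybrid embed_mul_hybrid embed_adj hybrid_mul_embed hc.
by rewrite hybridZ hybrid_put.
Qed.

End Hybrid.

Lemma conjugates_comp n (U V : endo R (qubits n)) f h :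
  conjugates U f -> conjugates V h -> conjugates (U *m V) (f \o h).
Proof.
move=> hU hV w; have [d d1 hd] := hV w; have [c c1 hc] := hU (h w).
exists (d * c); first by rewrite normrM c1 d1 mulr1.
rewrite mulmx_adj -scalerA -hc scalemxAl scalemxAr -hd.
by rewrite !mulmxA.
Qed.

Lemma conjugates1 n : conjugates (1%:M : endo R (qubits n)) id.
Proof.
by move=> w; exists 1; rewrite ?normr1 // trmx1 map_mx1 mulmx1 mul1mx scale1r.
Qed.

Lemma unitarymx1 n : (1%:M : 'M[C]_n) \is unitarymx.
Proof. by apply/unitarymxP; rewrite trmx1 map_mx1 mulmx1. Qed.
End Embedding.

Section Layers.
Variables (n xi M : nat).
Hypothesis hM : (M.+1 * xi <= n)%N.
Variable act : 'I_M -> pstring (2 * xi) -> pstring (2 * xi).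

Definition gate_step (w : pstring n) (j : 'I_M) : pstring n :=
  put (j * xi) (act j (win ord0 (2 * xi) (j * xi) w)) w.

Definition layer (r : seq 'I_M) (w : pstring n) : pstring n := foldl gate_step w r.

Lemma gate_range (j : 'I_M) : (j * xi + 2 * xi <= n)%N.
Proof.
by apply: leq_trans hM; rewrite -mulnDl leq_mul2r addn2 ltnS ltn_ord orbT.
Qed.

Lemma layer_disjoint r w m o :
  (forall j : 'I_M, j \in r -> (o + m <= j * xi)%N || (j * xi + 2 * xi <= o)%N) ->
  win ord0 m o (layer r w) = win ord0 m o w.
Proof.
elim: r w => //= j r IH w h.
rewrite IH => [|i ir]; last by apply: h; rewrite inE ir orbT.
by rewrite win_put_disjoint //; apply: h; rewrite inE eqxx.
Qed.

Lemma gates_disjoint (i j : 'I_M) : i != j -> odd i = odd j ->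
  (i * xi + 2 * xi <= j * xi)%N || (j * xi + 2 * xi <= i * xi)%N.
Proof.
move=> ij oij; rewrite -!mulnDl !leq_mul2r.
have : (i != j :> nat) by [].
by case: (ltngtP i j) => // h _; apply/orP; [left|right]; apply/orP; right; lia.
Qed.

(** Distinct gates of equal parity have disjoint windows, so each one meets the original string in
    its own window. *)
Lemma layer_gate b r w j : uniq r -> (forall i : 'I_M, i \in r -> odd i = b) -> j \in r ->
  win ord0 (2 * xi) (j * xi) (layer r w) = act j (win ord0 (2 * xi) (j * xi) w).
Proof.
elim: r w => //= i r IH w /andP [ir ur] hr.
have odd_r k : k \in r -> odd k = b by move=> kr; apply: hr; rewrite inE kr orbT.
have odd_i : odd i = b by apply: hr; rewrite inE eqxx.
rewrite inE; case: eqVneq => [-> _|ji /= jr].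
  rewrite layer_disjoint => [|k kr].
    by rewrite /gate_step win_put // gate_range.
  apply: gates_disjoint; last by rewrite odd_i odd_r.
  by apply: contraNneq ir => ->.
rewrite IH // /gate_step win_put_disjoint // gates_disjoint //.
by rewrite odd_i odd_r.
Qed.

End Layers.

Section Circuit.
Variables (R : realType) (n xi : nat).
Let M := (n %/ xi).-1.
Hypothesis xi_gt0 : (0 < xi)%N.
Hypothesis hM : (M.+1 * xi <= n)%N.
Variable g : {ffun 'I_M -> clifford_class R (2 * xi)}.

Local Notation pulls := (fun j => @clifford_pull R (2 * xi) (g j)).

Definition gates (b : bool) : seq 'I_M := [seq j : 'I_M <- index_enum 'I_M | odd j == b].

(* U^* P U with U = U2 U1 meets the second layer, that of the odd gates, first. *)
Definition circuit_action (w : pstring n) : pstring n :=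
  layer pulls (gates false) (layer pulls (gates true) w).

Let E (j : 'I_M) : endo R (qubits n) := embed n (j * xi) (clifford_mx (g j)).

Lemma prod_gates_unitary (r : seq 'I_M) : \prod_(j <- r) E j \is unitarymx.
Proof.
elim: r => [|j r IH]; first by rewrite big_nil; exact: unitarymx1.
rewrite big_cons; apply: mul_unitarymx IH; apply: embed_unitary (clifford_mx_unitary _).
exact: gate_range.
Qed.

(** The adjoint reverses the product, so the leftmost gate acts first, which is the order of [foldl]
    in [layer]. *)
Lemma prod_gates_conjugates (r : seq 'I_M) :
  conjugates ((\prod_(j <- r) E j)^t*) (layer pulls r).
Proof.
elim: r => [|j r IH].
  by rewrite big_nil trmx1 map_mx1; exact: conjugates1.
rewrite big_cons mulmx_adj; apply: (conjugates_comp IH).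
rewrite /E embed_adj; apply: embed_conjugates; first exact: gate_range.
exact: pull_conjugates.
Qed.

Let U := @blocked_circuit R n xi (fun j => clifford_mx (g j)).

Lemma circuitE : U = (\prod_(j <- gates true) E j) *m (\prod_(j <- gates false) E j).
Proof.
rewrite /U /blocked_circuit /gates !big_filter; congr (_ *m _); apply: eq_bigl => j.
  by rewrite eqb_id.
by rewrite eqbF_neg.
Qed.

Lemma circuit_unitary : U \is unitarymx.
Proof. by rewrite circuitE; apply: mul_unitarymx; exact: prod_gates_unitary. Qed.

Lemma circuit_conjugates : conjugates (U^t*) circuit_action.
Proof.
by rewrite circuitE mulmx_adj; apply: conjugates_comp; exact: prod_gates_conjugates.
Qed.

End Circuit.

(** * Fidelity and the Choi error *)

Section PsdMatrices.
Variable C : numClosedFieldType.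

Definition hpsd m (A : 'M[C]_m) :=
  A^t* = A /\ forall v : 'rV[C]_m, 0 <= (v *m A *m v^t*) ord0 ord0.

(** The formula of [sqrtmx], over an arbitrary closed field. *)
Definition sqrtm m (A : 'M[C]_m) : 'M[C]_m :=
  invmx (spectralmx A) *m diag_mx (map_mx sqrtC (spectral_diag A)) *m spectralmx A.

Lemma hpsd_spectral m (A : 'M[C]_m) : hpsd A ->
  exists (P : 'M[C]_m) (d : 'rV[C]_m), [/\ P *m P^t* = 1%:M,
    A = P^t* *m diag_mx d *m P, forall i, 0 <= d 0 i &
    sqrtm A = P^t* *m diag_mx (map_mx sqrtC d) *m P].
Proof.
move=> [hA pA]; exists (spectralmx A), (spectral_diag A).
have uP := spectral_unitarymx A.
have nA : A \is normalmx by apply/normalmxP; rewrite hA.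
have E : A = (spectralmx A)^t* *m diag_mx (spectral_diag A) *m spectralmx A.
  by rewrite -invmx_unitary //; exact/orthomx_spectralP.
have P1 := unitarymxP uP.
split=> //; last by rewrite /sqrtm invmx_unitary.
move: E P1 {uP nA}; move: (spectralmx A) (spectral_diag A) => P d E P1 i.
have := pA (row i P).
suff -> : row i P *m A *m (row i P)^t* = (d 0 i)%:M by rewrite mxE eqxx.
rewrite [row i P]rowE E mulmx_adj !mulmxA -(mulmxA _ P (P^t*)) P1 mulmx1.
rewrite -(mulmxA _ P (P^t*)) P1 mulmx1; apply/matrixP => a b; rewrite !ord1.
rewrite mxE (bigD1 i) //= big1 => [|k ki].
  by rewrite -rowE !mxE !eqxx /= conjC1 mulr1 addr0.
by rewrite !mxE (negbTE ki) andbF /= conjC0 mulr0.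
Qed.

Lemma sqrtm_hpsd m (A : 'M[C]_m) : hpsd A ->
  (sqrtm A)^t* = sqrtm A /\ sqrtm A *m sqrtm A = A.
Proof.
move=> /hpsd_spectral [P [d [P1 -> d0 ->]]]; split.
  rewrite !mulmx_adj trmxCK mulmxA; congr (_ *m _ *m _).
  apply/matrixP => i j; rewrite !mxE eq_sym.
  case: eqP => [->|_]; last by rewrite !mulr0n conjC0.
  by rewrite !mulr1n; apply/CrealP/ger0_real; rewrite sqrtC_ge0.
rewrite !mulmxA -(mulmxA _ P (P^t*)) P1 mulmx1; congr (_ *m _).
rewrite -mulmxA; congr (_ *m _); rewrite mulmx_diag; congr diag_mx.
by apply/rowP => i; rewrite !mxE -expr2 sqrtCK.
Qed.

(** On eigenvalues: a sum of squares of nonnegative numbers is at most the square of their sum. *)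
Lemma tr_sqrtm_hpsd m (A : 'M[C]_m) : hpsd A ->
  0 <= \tr (sqrtm A) /\ \tr A <= (\tr (sqrtm A)) ^+ 2.
Proof.
move=> /hpsd_spectral [P [d [P1 -> d0 ->]]].
have trP (e : 'rV_m) : \tr (P^t* *m diag_mx e *m P) = \sum_i e 0 i.
  by rewrite mxtrace_mulC mulmxA P1 mul1mx mxtrace_diag.
rewrite !trP.
have s0 i : 0 <= map_mx sqrtC d 0 i by rewrite mxE sqrtC_ge0.
split; first exact: sumr_ge0.
rewrite expr2 mulr_suml; apply: ler_sum => i _.
rewrite mulr_sumr (bigD1 i) //= -[leLHS]addr0; apply: lerD.
  by rewrite mxE -expr2 sqrtCK.
by apply: sumr_ge0 => j _; rewrite mulr_ge0.
Qed.

Lemma hpsd_gram m p (M : 'M[C]_(p, m)) : hpsd (M^t* *m M).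
Proof.
split; first by rewrite mulmx_adj trmxCK.
move=> v; have -> : v *m (M^t* *m M) *m v^t* = (v *m M^t*) *m (v *m M^t*)^t*.
  by rewrite mulmx_adj trmxCK !mulmxA.
by rewrite mxE; apply: sumr_ge0 => i _; rewrite !mxE -normCK exprn_ge0.
Qed.

Lemma tr_sqrtm_mul m (rho sigma : 'M[C]_m) : hpsd rho -> hpsd sigma ->
  \tr ((sqrtm rho *m sqrtm sigma)^t* *m (sqrtm rho *m sqrtm sigma)) =
  \tr (rho *m sigma).
Proof.
move=> /sqrtm_hpsd [r1 r2] /sqrtm_hpsd [s1 s2].
rewrite mulmx_adj r1 s1; move: r2 s2 {r1 s1}.
move: (sqrtm rho) (sqrtm sigma) => a b <- <-.
by rewrite -mulmxA mxtrace_mulC !mulmxA.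
Qed.

Lemma hpsd_sum m (I : finType) (c : I -> C) (A : I -> 'M[C]_m) :
  (forall i, 0 <= c i) -> (forall i, hpsd (A i)) -> hpsd (\sum_i c i *: A i).
Proof.
move=> c0 hA; split.
  rewrite linear_sum /= map_mx_sum; apply: eq_bigr => i _.
  rewrite linearZ /= map_mxZ (hA i).1.
  by congr (_ *: _); apply/CrealP/ger0_real.
move=> v; rewrite mulmx_sumr mulmx_suml summxE; apply: sumr_ge0 => i _.
by rewrite -scalemxAr -scalemxAl mxE mulr_ge0 // (hA i).2.
Qed.

End PsdMatrices.

Section Fidelity.
Variable R : realType.
Local Notation C := R[i].

Lemma trace_norm_ge m (M : 'M[C]_m) :
  complex.Re (\tr (M^t* *m M)) <= trace_norm M ^+ 2.
Proof.
have key (t u : C) : 0 <= t -> u <= t ^+ 2 -> complex.Re u <= complex.Re t ^+ 2.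
  move=> t0; rewrite -(RRe_real (ger0_real t0)) -rmorphXn lecE => /andP [_].
  by case: t t0.
have [t0 h] := tr_sqrtm_hpsd (hpsd_gram M).
exact: key t0 h.
Qed.

(** The trace norm dominates the Hilbert-Schmidt norm, whose square at sqrt(rho) sqrt(sigma) is
    tr(rho sigma). *)
Lemma fidelity_ge m (rho sigma : 'M[C]_m) : hpsd rho -> hpsd sigma ->
  complex.Re (\tr (rho *m sigma)) <= fidelity rho sigma ^+ 2.
Proof.
move=> hr hs; apply: le_trans (trace_norm_ge _).
by have := tr_sqrtm_mul hr hs => ->.
Qed.

Lemma purified_distance_le m (rho sigma : 'M[C]_m) x : hpsd rho -> hpsd sigma ->
  x <= complex.Re (\tr (rho *m sigma)) ->
  purified_distance rho sigma <= Num.sqrt (1 - x).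
Proof.
move=> hr hs hx; apply: ler_wsqrtr; rewrite lerD2l lerN2.
exact: le_trans hx (fidelity_ge hr hs).
Qed.

Section Channels.
Variables (S L : finType) (I : finType).
Variable K : I -> 'M[C]_(#|{: L}|, #|{: S}|).

Definition kraus (rho : endo R S) : endo R L := \sum_i K i *m rho *m (K i)^t*.

Lemma kraus_linear : linear kraus.
Proof.
move=> a u v; rewrite /kraus scaler_sumr -big_split /=; apply: eq_bigr => i _.
by rewrite mulmxDr mulmxDl -scalemxAr -scalemxAl.
Qed.

HB.instance Definition _ := GRing.isLinear.Build C (endo R S) (endo R L) _ kraus kraus_linear.

Lemma kraus_cp : completely_positive kraus.
Proof.
move=> m X pX v.
(* T i is K i tensored with the identity; conjugation by it preserves positivity. *)
pose T i : 'M[C]_(#|{: L * 'I_m}|, #|{: S * 'I_m}|) := \matrix_(a, b)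
  (K i (enum_rank (enum_val a).1) (enum_rank (enum_val b).1) *
   ((enum_val a).2 == (enum_val b).2)%:R).
have TE i l e s f : T i (enum_rank (l, e)) (enum_rank (s, f)) =
    K i (enum_rank l) (enum_rank s) * (e == f)%:R.
  by rewrite mxE !enum_rankK.
have pairE (G : S * 'I_m -> C) : \sum_u G u = \sum_s \sum_f G (s, f).
  by rewrite pair_bigA /=; apply: eq_bigr => -[].
have -> : tens_id kraus X = \sum_i T i *m X *m (T i)^t*.
  apply: coef_inj => -[l e] [l' e']; rewrite coef_opmx /= /coef !summxE.
  apply: eq_bigr => i _; rewrite !coef_mul pairE.
  apply: eq_bigr => s' _; rewrite (bigD1 e') //= [X in _ + X]big1 ?addr0; last first.
    by move=> f ff; rewrite coef_adj TE eq_sym (negbTE ff) mulr0 conjC0 mulr0.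
  rewrite !coef_adj TE eqxx mulr1; congr (_ * _).
  rewrite !coef_mul pairE.
  apply: eq_bigr => s _; rewrite (bigD1 e) //= [X in _ + X]big1 ?addr0; last first.
    by move=> f ff; rewrite TE eq_sym (negbTE ff) mulr0 mul0r.
  by rewrite TE eqxx mulr1 -[X in _ * X = _]/(coef _ _ _) coef_opmx.
rewrite mulmx_sumr mulmx_suml summxE; apply: sumr_ge0 => i _.
by have := pX (v *m T i); rewrite mulmx_adj !mulmxA.
Qed.

Lemma kraus_tp : \sum_i (K i)^t* *m K i = 1%:M -> trace_preserving kraus.
Proof.
move=> hK A; rewrite /kraus linear_sum /=.
under eq_bigr => i _ do rewrite mxtrace_mulC mulmxA.
by rewrite -linear_sum -mulmx_suml hK mul1mx.
Qed.

End Channels.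

(** * The Choi error in terms of Kraus operators *)

Section ChoiError.
Variables (L S : finType).

(** The bra of the vectorization of A, so that its Gram matrix is the unnormalized projector onto
    the vector with entries A(l, u); A = 1 gives the maximally entangled state up to the factor
    1/d. *)
Definition vecmx (A : endo R L) : 'M[C]_(1, #|{: L * L}|) :=
  \matrix_(_, a) (coef A (enum_val a).1 (enum_val a).2)^*%R.

Lemma coef_vecmx A (a b : L * L) :
  coef ((vecmx A)^t* *m vecmx A) a b = coef A a.1 a.2 * (coef A b.1 b.2)^*%R.
Proof. by rewrite /coef mxE big_ord1 !mxE !enum_rankK conjCK. Qed.

Lemma tr_vecmx A B :
  \tr ((vecmx A)^t* *m vecmx A *m ((vecmx B)^t* *m vecmx B)) =
  `|\tr (A^t* *m B)| ^+ 2.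
Proof.
rewrite mulmxA mxtrace_mulC !mulmxA -mulmxA.
have trE (X Y : endo R L) : vecmx X *m (vecmx Y)^t* = (\tr (X^t* *m Y))%:M.
  apply/matrixP => i j; rewrite !ord1 !mxE eqxx mulr1n /mxtrace.
  have -> : \sum_i (X^t* *m Y) i i = \sum_l \sum_u (coef X u l)^*%R * coef Y u l.
    rewrite (reindex enum_rank) /=; last by apply: onW_bij; exact: enum_rank_bij.
    apply: eq_bigr => l _; rewrite coef_mul; apply: eq_bigr => u _.
    by rewrite coef_adj.
  rewrite exchange_big pair_bigA /= (reindex enum_rank) /=; last first.
    by apply: onW_bij; exact: enum_rank_bij.
  by apply: eq_bigr => u _; rewrite !mxE !enum_rankK conjCK.
rewrite !trE -scalar_mxM mxtrace_scalar mulr1n normCK mulrC; congr (_ * _).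
have -> : B^t* *m A = (A^t* *m B)^t* by rewrite mulmx_adj trmxCK.
by rewrite /mxtrace rmorph_sum; apply: eq_bigr => i _; rewrite !mxE.
Qed.

Lemma hpsd_vecmx A : hpsd ((vecmx A)^t* *m vecmx A).
Proof. exact: hpsd_gram. Qed.

Let dinv : C := #|L|%:R^-1.

Lemma max_entangledE :
  max_entangled R L = dinv *: ((vecmx 1%:M)^t* *m vecmx 1%:M).
Proof.
apply: coef_inj => -[a a'] [b b']; rewrite coef_opmx /= coef_scale coef_vecmx /=.
rewrite !coef_scalar mulrC -/dinv; congr (_ * _).
by case: eqP => _; case: eqP => _; rewrite ?mulr0n ?conjC0 ?mulr0 ?mul0r ?conjC1 ?mulr1.
Qed.

Variables (J I : finType) (c : J -> R) (B : J -> 'M[C]_(#|{: S}|, #|{: L}|)).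
Variable K : I -> 'M[C]_(#|{: L}|, #|{: S}|).
Variable NE : endo R L -> endo R S.
Hypothesis c_ge0 : forall j, 0 <= c j.
Hypothesis NE_kraus : forall rho, NE rho = \sum_j (c j)%:C *: (B j *m rho *m (B j)^t*).
Hypothesis K_tp : \sum_i (K i)^t* *m K i = 1%:M.

Let D : {linear endo R S -> endo R L} := kraus K.

(** Applying A to the first half of the vectorized identity gives the vectorization of A; here A
    runs over the products of a decoder and a noise operator. *)
Lemma tens_id_max_entangled :
  tens_id (D \o NE) (max_entangled R L) = \sum_(ij : I * J) (dinv * (c ij.2)%:C) *:
    ((vecmx (K ij.1 *m B ij.2))^t* *m vecmx (K ij.1 *m B ij.2)).
Proof.
apply: coef_inj => -[l e] [l' e']; rewrite coef_opmx /=.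
set rho := opmx _.
have -> : rho = dinv *: ketbra R e e'.
  apply: coef_inj => s t; rewrite coef_opmx coef_opmx /= coef_scale mulrC -/dinv.
  by congr (_ * _); rewrite /coef mxE !(inj_eq enum_rank_inj).
rewrite NE_kraus /D /= /kraus.
have -> : \sum_i K i *m (\sum_j (c j)%:C *: (B j *m (dinv *: ketbra R e e') *m (B j)^t*))
   *m (K i)^t* = \sum_(ij : I * J) (dinv * (c ij.2)%:C) *:
     ((K ij.1 *m B ij.2) *m ketbra R e e' *m (K ij.1 *m B ij.2)^t*).
  rewrite -(pair_bigA _ (fun i j => (dinv * (c j)%:C) *:
     ((K i *m B j) *m ketbra R e e' *m (K i *m B j)^t*))) /=.
  apply: eq_bigr => i _; rewrite mulmx_sumr mulmx_suml; apply: eq_bigr => j _.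
  rewrite -!(scalemxAl, scalemxAr) scalerA mulrC mulmx_adj; congr (_ *: _).
  by rewrite !mulmxA.
rewrite /coef !summxE; apply: eq_bigr => -[i j] _ /=.
rewrite [LHS]mxE [RHS]mxE; congr (_ * _).
rewrite -[RHS]/(coef _ (l, e) (l', e')) coef_vecmx /=.
move: (K i *m B j) => A.
rewrite coef_mul (bigD1 e') //= big1 ?addr0 => [|u ue]; last first.
  rewrite coef_mul big1 ?mul0r // => v _.
  by rewrite mxE !(inj_eq enum_rank_inj) (negbTE ue) andbF mulr0.
rewrite coef_adj; congr (_ * _).
rewrite coef_mul (bigD1 e) //= big1 ?addr0 => [|u ue]; last first.
  by rewrite mxE !(inj_eq enum_rank_inj) (negbTE ue) mulr0.
by rewrite mxE !eqxx mulr1.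
Qed.

(* The entanglement fidelity of a channel with Kraus operators A is the sum of *)
(* the |tr A|^2 / d^2.                                                         *)
Lemma choi_error_le (x : R) :
  x%:C <= \sum_i \sum_j (c j)%:C * (`|\tr (K i *m B j)| / #|L|%:R) ^+ 2 ->
  choi_error NE <= Num.sqrt (1 - x).
Proof.
move=> hx; have qD : quantum_channel D.
  by split; [exact: kraus_cp | exact: kraus_tp].
apply: (@le_trans _ _ (purified_distance (max_entangled R L)
    (tens_id (D \o NE) (max_entangled R L)))).
  rewrite /choi_error; apply: ge_inf; last by exists D.
  by exists 0 => _ [D' _ <-]; rewrite /purified_distance sqrtr_ge0.
have d0 : 0 <= dinv by rewrite invr_ge0 ler0n.
apply: purified_distance_le.
- rewrite max_entangledE; have := @hpsd_sum C _ 'I_1 (fun=> dinv) (fun=> (vecmx 1%:M)^t* *m vecmx 1%:M).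
  by rewrite big_ord1; apply=> // _; exact: hpsd_vecmx.
- rewrite tens_id_max_entangled; apply: hpsd_sum => [ij|ij]; last exact: hpsd_vecmx.
  by rewrite mulr_ge0 // ler0c.
- move: hx; rewrite lecE => /andP [_ hx']; apply: (le_trans hx'); rewrite le_eqVlt; apply/orP; left.
  apply/eqP; congr complex.Re.
  rewrite tens_id_max_entangled max_entangledE mulmx_sumr linear_sum /=.
  rewrite pair_bigA /=.
  apply: eq_bigr => -[i j] _ /=.
  rewrite -scalemxAl -scalemxAr !mxtraceZ tr_vecmx.
  by rewrite trmx1 map_mx1 mul1mx exprMn -/dinv; ring.
Qed.

End ChoiError.
End Fidelity.

(** * The decoder *)

Section Decoder.
Variables (R : realType) (n k xi c : nat).
Local Notation C := R[i].
Let kappa := (k * xi %/ n)%N.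
Hypothesis xi_gt0 : (0 < xi)%N.
Hypothesis n_eq : n = (c * xi)%N.
Hypothesis k_eq : k = (c * kappa)%N.
Hypothesis kappa_le : (kappa <= xi)%N.

(** The right inverse of [logical_part] with zero ancillas; the encoder is conjugation by the
    isometry |l> to |place l>. *)
Definition place (l : qubits k) : qubits n :=
  [ffun q : 'I_n => if (q %% xi < kappa)%N then bit l (q %/ xi * kappa + q %% xi)
                    else false].

Lemma place_ancillas l : ancillas_zero xi kappa (place l).
Proof. by apply/forallP => q; apply/implyP; rewrite ffunE leqNgt => /negbTE ->. Qed.

Lemma placeK : cancel place (@logical_part n k xi kappa).
Proof.
move=> l; apply/ffunP => a; rewrite ffunE.
have a_lt := ltn_ord a; have kpos : (0 < kappa)%N by case: kappa k_eq a_lt => [|//]; lia.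
have r_lt : (a %% kappa < kappa)%N by rewrite ltn_pmod.
have d_lt : (a %/ kappa < c)%N by rewrite ltn_divLR // -k_eq.
have q_lt : (a %/ kappa * xi + a %% kappa < n)%N.
  rewrite n_eq (@leq_trans ((a %/ kappa).+1 * xi)) ?leq_mul2r ?d_lt ?orbT //.
  by rewrite mulSn addnC ltn_add2r (leq_trans r_lt).
have r_xi : (a %% kappa < xi)%N by rewrite (leq_trans r_lt).
rewrite /bit (insubT (fun i => (i < n)%N) q_lt) /= ffunE /=.
rewrite modnMDl (modn_small r_xi) r_lt divnMDl // (divn_small r_xi) addn0 -divn_eq.
by rewrite /bit (insubT (fun i => (i < k)%N) a_lt) /=; congr (l _); apply: val_inj.
Qed.

Lemma logical_partK s : ancillas_zero xi kappa s ->
  place (logical_part k xi kappa s) = s.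
Proof.
move=> /forallP hs; apply/ffunP => q; rewrite ffunE; have := hs q.
case: ltnP => [r_lt _|_ /= /negbTE -> //].
have kpos : (0 < kappa)%N by apply: leq_trans r_lt.
have q_lt := ltn_ord q.
have d_lt : (q %/ xi < c)%N by rewrite ltn_divLR // -n_eq.
have a_lt : (q %/ xi * kappa + q %% xi < k)%N.
  rewrite [X in (_ < X)%N]k_eq (@leq_trans ((q %/ xi).+1 * kappa)) ?leq_mul2r ?d_lt ?orbT //.
  by rewrite mulSn addnC ltn_add2r.
rewrite /bit (insubT (fun i => (i < k)%N) a_lt) /= ffunE /=.
rewrite modnMDl (modn_small r_lt) divnMDl // (divn_small r_lt) addn0 -divn_eq.
by rewrite /bit (insubT (fun i => (i < n)%N) q_lt) /=; congr (s _); apply: val_inj.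
Qed.

Definition isometry : 'M[C]_(#|{: qubits n}|, #|{: qubits k}|) :=
  \matrix_(a, b) (enum_val a == place (enum_val b))%:R.
Local Notation W := isometry.

Lemma coef_isometry s l : W (enum_rank s) (enum_rank l) = (s == place l)%:R.
Proof. by rewrite mxE !enum_rankK. Qed.

Lemma place_inj : injective place. Proof. exact: can_inj placeK. Qed.

Lemma eq_place s l :
  (s == place l) = ancillas_zero xi kappa s && (logical_part k xi kappa s == l).
Proof.
apply/eqP/andP => [->|[h /eqP <-]]; first by rewrite place_ancillas placeK eqxx.
by rewrite logical_partK.
Qed.

Lemma isometry_adj_mul : W^t* *m W = 1%:M.
Proof.
apply: coef_inj => l l'; rewrite coef_scalar /coef coef_mul (bigD1 (place l)) //= big1 => [|s sl].
  by rewrite coef_adj !coef_isometry eqxx conjC1 mul1r addr0 (inj_eq place_inj).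
by rewrite coef_adj !coef_isometry (negbTE sl) conjC0 mul0r.
Qed.

Lemma coef_isometry_mul_adj s t :
  coef (W *m W^t*) s t = ((s == t) && ancillas_zero xi kappa s)%:R.
Proof.
rewrite /coef coef_mul.
under eq_bigr => l _ do rewrite coef_adj !coef_isometry conjC_nat.
have [hs|hs] := boolP (ancillas_zero xi kappa s); last first.
  by rewrite andbF big1 // => l _; rewrite eq_place (negbTE hs) mul0r.
rewrite andbT (bigD1 (logical_part k xi kappa s)) //= big1 => [|l ls].
  by rewrite logical_partK // eqxx mul1r addr0 eq_sym.
by rewrite eq_place eq_sym (negbTE ls) andbF mul0r.
Qed.

Lemma with_ancillasE (rho : endo R (qubits k)) :
  with_ancillas n xi rho = W *m rho *m W^t*.
Proof.
apply: coef_inj => s t; rewrite coef_opmx -/kappa /coef coef_mul.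
under eq_bigr => l' _ do rewrite coef_adj coef_isometry conjC_nat.
have [ht|ht] := boolP (ancillas_zero xi kappa t); last first.
  by rewrite andbF big1 // => l _; rewrite eq_place (negbTE ht) mulr0.
rewrite andbT (bigD1 (logical_part k xi kappa t)) //= big1 => [|l ls]; last first.
  by rewrite eq_place eq_sym (negbTE ls) andbF mulr0.
rewrite logical_partK // eqxx mulr1 addr0 coef_mul.
under eq_bigr => l _ do rewrite coef_isometry.
have [hs|hs] := boolP (ancillas_zero xi kappa s); last first.
  by rewrite big1 // => l _; rewrite eq_place (negbTE hs) mul0r.
rewrite (bigD1 (logical_part k xi kappa s)) //= big1 => [|l ls]; last first.
  by rewrite eq_place eq_sym (negbTE ls) andbF mul0r.
by rewrite logical_partK // eqxx mul1r addr0.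
Qed.

Definition ancilla_part (s : qubits n) : qubits n :=
  [ffun q : 'I_n => (kappa <= q %% xi)%N && s q].

Definition syndrome (w : pstring n) : qubits n :=
  ancilla_part [ffun q => xbit (w q)].

Lemma pauli_support (w : pstring n) s t : coef (pauli R w) s t != 0 ->
  t = [ffun q => s q (+) xbit (w q)].
Proof.
rewrite coef_pauli prodf_seq_neq0 => /allP h; apply/ffunP => q; rewrite ffunE.
have := h q; rewrite mem_index_enum => /(_ isT) /=.
by rewrite coef_opmx; case: (w q) (s q) (t q) => [[|[|[|[|//]]]] hw] [] [] //=;
  rewrite eqxx.
Qed.

(** Conjugating the code projector by a string gives the projector onto the states whose ancillas
    read its syndrome: row s of the Pauli has the single nonzero column u, and the phases cancel
    since the Pauli squares to 1. *)
Lemma pauli_conj_isometry (w : pstring n) s t :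
  coef (pauli R w *m (W *m W^t*) *m pauli R w) s t =
  ((s == t) && (ancilla_part s == syndrome w))%:R.
Proof.
pose u : qubits n := [ffun q => s q (+) xbit (w q)].
have cu v : v != u -> coef (pauli R w) s v = 0.
  by move=> vu; apply/eqP; apply: contraNT vu => /pauli_support ->.
have E : coef (pauli R w) s u * coef (pauli R w) u t = (s == t)%:R.
  have := congr1 (fun A => coef A s t) (pauli_sqr R w).
  rewrite Defs.coefM coef_scalar (bigD1 u) //= big1 ?addr0 //.
  by move=> v vu; rewrite cu // mul0r.
rewrite -mulmxA Defs.coefM (bigD1 u) //= [X in _ + X]big1 ?addr0; last first.
  by move=> v vu; rewrite cu // mul0r.
rewrite Defs.coefM (bigD1 u) //= [X in _ + X]big1 ?addr0; last first.
  by move=> v vu; rewrite coef_isometry_mul_adj eq_sym (negbTE vu) mul0r.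
rewrite coef_isometry_mul_adj eqxx /= mulrCA E -natrM mulnb andbC.
congr (nat_of_bool (_ && _))%:R.
apply/forallP/eqP => [h|h q].
  apply/ffunP => q; rewrite !ffunE; have := h q; rewrite ffunE.
  by case: (kappa <= _)%N => //=; case: (s q) (xbit _) => [] [].
have := congr1 (fun f : qubits n => f q) h; rewrite !ffunE.
by case: (kappa <= _)%N => //=; case: (s q) (xbit _) => [] [].
Qed.

Variables (U : endo R (qubits n)) (tau : pstring n -> pstring n).
Hypothesis uU : U \is unitarymx.
Hypothesis Utau : conjugates (U^t*) tau.
Variable T : {set pstring n}.

Definition flip (s : qubits n) : pstring n :=
  [ffun q => if s q then @Ordinal 4 1 isT else ord0].

(** The fallback [flip s] also has syndrome s when s lives on the ancillas. Hence the projectors for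
    distinct syndromes are orthogonal and sum to 1, which makes the decoder trace preserving. *)
Definition correction (s : qubits n) : pstring n :=
  if [pick w in T | syndrome (tau w) == s] is Some w then tau w else flip s.

Lemma syndrome_correction s : ancilla_part s = s -> syndrome (correction s) = s.
Proof.
move=> hs; rewrite /correction; case: pickP => [w /andP [_ /eqP] //|_].
rewrite -[RHS]hs; apply/ffunP => q; rewrite !ffunE.
by case: (s q).
Qed.

(* Only the patterns supported on the ancillas are syndromes. *)
Definition decoder (s : qubits n) : 'M[C]_(#|{: qubits k}|, #|{: qubits n}|) :=
  if ancilla_part s == s then W^t* *m pauli R (correction s) *m U^t* else 0.

Lemma decoder_tp : \sum_s (decoder s)^t* *m decoder s = 1%:M.
Proof.
have [U1 U2] := unitary_adjM uU.
transitivity (U *m (\sum_(s : qubits n | ancilla_part s == s)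
    pauli R (correction s) *m (W *m W^t*) *m pauli R (correction s)) *m U^t*).
  rewrite mulmx_sumr mulmx_suml [RHS]big_mkcond /=; apply: eq_bigr => s _.
  rewrite /decoder; case: eqP => _; last by rewrite mulmx0.
  by rewrite !mulmx_adj !trmxCK pauli_adj !mulmxA.
rewrite (_ : \sum_(s | _) _ = 1%:M) ?mulmx1 //.
apply: coef_inj => s t; rewrite coef_scalar /coef summxE.
have idem : ancilla_part (ancilla_part s) = ancilla_part s.
  by apply/ffunP => q; rewrite !ffunE andbA andbb.
transitivity (\sum_(s0 : qubits n | ancilla_part s0 == s0)
    ((s == t) && (ancilla_part s == s0))%:R : C).
  apply: eq_bigr => s0 /eqP hs0; rewrite -[LHS]/(coef _ s t) pauli_conj_isometry.
  by rewrite syndrome_correction.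
rewrite (bigD1 (ancilla_part s)) /=; last by rewrite idem.
rewrite eqxx andbT big1 ?addr0 // => s0 /andP [_ /negbTE h].
by rewrite eq_sym in h; rewrite h andbF.
Qed.

(** Uniqueness forces [pick] in [correction] to return w itself. *)
Definition correctable (w : pstring n) : bool :=
  (w \in T) && [forall v in T, (syndrome (tau v) == syndrome (tau w)) ==> (v == w)].

Lemma correctionE w : correctable w -> correction (syndrome (tau w)) = tau w.
Proof.
move=> /andP [wT /forallP h]; rewrite /correction; case: pickP => [v /andP [vT sv]|/(_ w)].
  by have := h v; rewrite vT sv /= => /eqP ->.
by rewrite wT eqxx.
Qed.

Variable p : 'I_4 -> R.
Hypothesis p_ge0 : forall w, 0 <= p w.

Definition pweight m (w : pstring m) : R := \prod_q p (w q).

Lemma pauli_noiseE (rho : endo R (qubits n)) :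
  pauli_noise p rho = \sum_w (pweight w)%:C *: (pauli R w *m rho *m pauli R w).
Proof.
apply: coef_inj => s' t'; rewrite coef_opmx.
transitivity (\sum_s \sum_t \sum_(w : pstring n) coef rho s t *
    ((pweight w)%:C * (coef (pauli R w) s' s * coef (pauli R w) t t'))).
  apply: eq_bigr => s _; apply: eq_bigr => t _; rewrite -mulr_sumr; congr (_ * _).
  have E q : coef (pauli_noise1 p (ketbra R (s q) (t q))) (s' q) (t' q) =
     \sum_(w < 4) (p w)%:C * (coef (pauli1 R w) (s' q) (s q) * coef (pauli1 R w) (t q) (t' q)).
    rewrite /pauli_noise1 {1}/coef summxE; apply: eq_bigr => w _.
    rewrite mxE; congr (_ * _); rewrite -[LHS]/(coef _ _ _) Defs.coefM.
    rewrite (bigD1 (t q)) //= big1 => [|b bt]; last first.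
      rewrite Defs.coefM big1 ?mul0r // => b' _.
      by rewrite [X in _ * X]mxE !(inj_eq enum_rank_inj) (negbTE bt) andbF mulr0.
    rewrite addr0 Defs.coefM (bigD1 (s q)) //= big1 => [|b bt]; last first.
      by rewrite [X in _ * X]mxE !(inj_eq enum_rank_inj) (negbTE bt) mulr0.
    by rewrite [X in _ * X + _]mxE !eqxx mulr1 addr0.
  rewrite (eq_bigr _ (fun q _ => E q)) bigA_distr_bigA /=; apply: eq_bigr => w _.
  by rewrite big_split big_split /= -!coef_pauli /pweight rmorph_prod.
rewrite exchange_big /= [in RHS]/coef summxE.
under eq_bigr => t _ do rewrite exchange_big /=.
rewrite exchange_big /=; apply: eq_bigr => w _.
rewrite mxE -[X in _ = _ * X]/(coef _ _ _) Defs.coefM mulr_sumr; apply: eq_bigr => t _.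
rewrite Defs.coefM mulr_suml mulr_sumr; apply: eq_bigr => s _; ring.
Qed.

(** For correctable w, the decoder operator of its syndrome applied after the error and the encoder
    is a phase times the identity, contributing the full weight of w. All other terms are
    nonnegative and are dropped. *)
Lemma choi_error_correctable :
  choi_error (pauli_noise p \o @encoding R n k xi U) <=
  Num.sqrt (1 - \sum_(w | correctable w) pweight w).
Proof.
have [U1 U2] := unitary_adjM uU.
have pw0 w : 0 <= pweight w :> R by exact: prodr_ge0.
have L0 : (0 < #|{: qubits k}|)%N by apply/card_gt0P; exists [ffun=> false].
apply: (@choi_error_le R (qubits k) (qubits n) {: pstring n} {: qubits n}
   (@pweight n) (fun w => pauli R w *m U *m W) decoder) => //.
- move=> rho; rewrite /= pauli_noiseE; apply: eq_bigr => w _; congr (_ *: _).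
  rewrite /encoding with_ancillasE !mulmx_adj pauli_adj !mulmxA //.
- exact: decoder_tp.
have term0 s w : 0 <= (pweight w)%:C *
    (`|\tr (decoder s *m (pauli R w *m U *m W))| / #|{: qubits k}|%:R) ^+ 2.
  by rewrite mulr_ge0 ?ler0c // exprn_ge0 // divr_ge0 // ler0n.
rewrite exchange_big /= rmorph_sum /= [leRHS](bigID correctable) /= -[leLHS]addr0.
apply: lerD; last by apply: sumr_ge0 => w _; apply: sumr_ge0.
apply: ler_sum => w gw; rewrite (bigD1 (syndrome (tau w))) //= -[leLHS]addr0.
apply: lerD; last by apply: sumr_ge0.
have -> : decoder (syndrome (tau w)) = W^t* *m pauli R (tau w) *m U^t*.
  rewrite /decoder correctionE // ifT //; apply/eqP/ffunP => q.
  by rewrite !ffunE andbA andbb.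
have [d d1 hd] := Utau w; rewrite trmxCK in hd.
have -> : W^t* *m pauli R (tau w) *m U^t* *m (pauli R w *m U *m W) = d *: 1%:M.
  transitivity (W^t* *m pauli R (tau w) *m (U^t* *m pauli R w *m U) *m W).
    by rewrite !mulmxA.
  rewrite hd -scalemxAr -scalemxAl -(mulmxA (W^t*)) pauli_sqr mulmx1.
  by rewrite isometry_adj_mul.
rewrite mxtraceZ mxtrace1 normrM d1 mul1r normr_nat divff ?expr1n ?mulr1 //.
by rewrite pnatr_eq0 -lt0n.
Qed.

End Decoder.

(** * Syndromes under random circuits *)

Section Regions.
Variables (xi : nat).
Hypothesis xi_gt0 : (0 < xi)%N.

Definition region n (r : nat) (w : pstring n) : pstring xi := win ord0 xi (r * xi) w.

Lemma region_pmul n r (v w : pstring n) :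
  region r (pmul v w) = pmul (region r v) (region r w).
Proof.
apply/ffunP => a; rewrite !ffunE; case: insubP => [q _ _|_] /=; first by rewrite ffunE.
by rewrite pmul1xx.
Qed.

Lemma region_pone n r : region r (@pone n) = pone.
Proof. by apply/ffunP => a; rewrite !ffunE; case: insubP => //= q _ _; rewrite ffunE. Qed.

Lemma region_index c (r : 'I_c) (a : 'I_xi) : (r * xi + a < c * xi)%N.
Proof.
by rewrite (@leq_trans (r.+1 * xi)) ?leq_mul2r ?ltn_ord ?orbT // mulSn addnC ltn_add2r.
Qed.

Lemma sum_regions (V : comNzRingType) n c (phi : 'I_c -> pstring xi -> V) :
  n = (c * xi)%N ->
  \sum_(w : pstring n) \prod_(r < c) phi r (region r w) =
  \prod_(r < c) \sum_(u : pstring xi) phi r u.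
Proof.
move=> ->.
have div_lt (q : 'I_(c * xi)) : (q %/ xi < c)%N by rewrite ltn_divLR.
have mod_lt (q : 'I_(c * xi)) : (q %% xi < xi)%N by rewrite ltn_pmod.
pose cut (w : pstring (c * xi)) : {ffun 'I_c -> pstring xi} := [ffun r : 'I_c => region r w].
pose glue (f : {ffun 'I_c -> pstring xi}) : pstring (c * xi) :=
  [ffun q : 'I_(c * xi) => f (Ordinal (div_lt q)) (Ordinal (mod_lt q))].
have cutK : cancel cut glue.
  move=> w; apply/ffunP => q; rewrite ffunE /cut ffunE /region winE /=.
    by rewrite -divn_eq.
  by move=> h; congr (w _); apply: val_inj; rewrite /= -divn_eq.
have glueK : cancel glue cut.
  move=> f; apply/ffunP => r; rewrite ffunE; apply/ffunP => a.
  rewrite /region (winE _ _ (region_index r a)) ffunE /=.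
  congr (f _ _); apply: val_inj => /=.
    by rewrite divnMDl // divn_small ?addn0.
  by rewrite modnMDl modn_small.
rewrite bigA_distr_bigA (reindex cut) /=; last by apply: onW_bij; exists glue.
by apply: eq_bigr => w _; apply: eq_bigr => r _; rewrite ffunE.
Qed.

Lemma prod_regions (V : comNzRingType) n c (f : 'I_4 -> V) (w : pstring n) :
  n = (c * xi)%N ->
  \prod_q f (w q) = \prod_(r < c) \prod_(a < xi) f (region r w a).
Proof.
move=> n_e; move: w; rewrite n_e => w.
have div_lt (q : 'I_(c * xi)) : (q %/ xi < c)%N by rewrite ltn_divLR.
rewrite (partition_big (fun q => Ordinal (div_lt q)) predT) //=.
apply: eq_bigr => r _.
rewrite (eq_bigl (fun q : 'I_(c * xi) => (r * xi <= q < r * xi + xi)%N)); last first.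
  move=> q; apply/eqP/idP => [<-|h] /=.
    by rewrite {2 3}(divn_eq q xi) leq_addr ltn_add2l ltn_pmod.
  by apply: val_inj => /=; apply/eqP; rewrite eqn_leq leq_divRL // -ltnS ltn_divLR // mulSn; lia.
apply: big_window => [|a q qa].
  by rewrite -mulSnr leq_mul2r ltn_ord orbT.
have h : (r * xi + a < c * xi)%N := region_index r a.
by rewrite /region (winE _ _ h); congr (f (w _)); apply: val_inj.
Qed.

Lemma region_eq_pone n c (w : pstring n) : n = (c * xi)%N ->
  (forall r : 'I_c, region r w = pone) -> w = pone.
Proof.
move=> n_e; move: w; rewrite n_e => w h; apply/ffunP => q.
have div_lt : (q %/ xi < c)%N by rewrite ltn_divLR.
have mod_lt : (q %% xi < xi)%N by rewrite ltn_pmod.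
have lt : (Ordinal div_lt * xi + Ordinal mod_lt < c * xi)%N by rewrite /= -divn_eq.
have := congr1 (fun u : pstring xi => u (Ordinal mod_lt)) (h (Ordinal div_lt)).
rewrite /region (winE _ _ lt) !ffunE => <-.
by congr (w _); apply: val_inj; rewrite /= -divn_eq.
Qed.

Lemma region_win n m o r (w : pstring n) : (r.+1 * xi <= m)%N ->
  region r (win ord0 m (o * xi) w) = region (o + r) w.
Proof.
by move=> h; rewrite /region win_win -?mulnDl // -mulSnr.
Qed.

End Regions.

(** For M odd, the even gates pair off the M + 1 regions exactly. *)
Lemma prod_even_pairs (V : comNzRingType) M (h : nat -> V) : odd M ->
  \prod_(j < M | ~~ odd j) (h j * h j.+1) = \prod_(r < M.+1) h r.
Proof.
move=> oM; rewrite -(odd_double_half M) oM add1n; move: (M./2) => N.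
elim: N => [|N IH].
  by rewrite big_mkcond double0 !big_ord_recl !big_ord0 /= !mulr1.
rewrite doubleS big_mkcond 2!big_ord_recr -big_mkcond /= IH /= odd_double /= mulr1.
by rewrite [RHS]big_ord_recr [in RHS]big_ord_recr /= mulrA.
Qed.

(* The gates of the second layer miss the two end regions. *)
Lemma prod_odd_pairs (V : comNzRingType) M (h : nat -> V) : odd M ->
  h 0%N * \prod_(j < M | odd j) (h j * h j.+1) * h M =
  \prod_(r < M.+1) h r.
Proof.
move=> oM; rewrite -(odd_double_half M) oM add1n; move: (M./2) => N.
elim: N => [|N IH].
  by rewrite big_mkcond double0 !big_ord_recl !big_ord0 /= !mulr1.
rewrite doubleS big_mkcond 2!big_ord_recr -big_mkcond /= odd_double /= mulr1.
rewrite [RHS]big_ord_recr [in RHS]big_ord_recr /= -IH; ring.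
Qed.

(** Independence: the sum over families factorizes over gates, and each gate outside P contributes
    the factor |G|. *)
Lemma sum_gates_le (V : realFieldType) (J G : finType) (P : pred J)
    (e : J -> G -> V) (b : J -> V) :
  (forall j x, P j -> 0 <= e j x) ->
  (forall j, P j -> \sum_x e j x <= #|G|%:R * b j) ->
  \sum_(g : {ffun J -> G}) \prod_(j | P j) e j (g j) <=
    #|{: {ffun J -> G}}|%:R * \prod_(j | P j) b j.
Proof.
move=> e0 eb; pose e' j x := if P j then e j x else 1.
have -> : \sum_(g : {ffun J -> G}) \prod_(j | P j) e j (g j) =
    \sum_(g : {ffun J -> G}) \prod_j e' j (g j).
  by apply: eq_bigr => g _; rewrite big_mkcond.
rewrite -(bigA_distr_bigA e') card_ffun natrX -prodr_const.
rewrite [X in _ <= _ * X]big_mkcond -big_split /=; apply: ler_prod => j _.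
rewrite /e'; case: (boolP (P j)) => Pj.
  by rewrite sumr_ge0 ?eb // => x _; exact: e0.
by rewrite sumr_const mulr1 ler0n lexx.
Qed.

(** Independence of the two layers: swapping the entries outside P is an involution on pairs of
    families, so the spliced family is uniform. *)
Lemma sum_mix (V : realFieldType) (J G : finType) (P : pred J) (f : {ffun J -> G} -> V) :
  #|{: {ffun J -> G}}|%:R * \sum_g f g =
  \sum_(g : {ffun J -> G}) \sum_(g' : {ffun J -> G}) f [ffun j => if P j then g j else g' j].
Proof.
pose mix (g g' : {ffun J -> G}) := [ffun j => if P j then g j else g' j].
pose sw (x : {ffun J -> G} * {ffun J -> G}) := (mix x.1 x.2, mix x.2 x.1).
have swK : cancel sw sw.
  by case=> g g'; congr (_, _); apply/ffunP => j; rewrite !ffunE /=; case: (P j).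
rewrite pair_bigA /=.
transitivity (\sum_(x : {ffun J -> G} * {ffun J -> G}) f (sw x).1); last by [].
rewrite -(reindex_inj (h := sw) (can_inj swK) (P := predT) (F := fun x => f x.1)).
rewrite -(pair_bigA _ (fun g g' => f g)) /= mulr_sumr; apply: eq_bigr => g _.
by rewrite sumr_const mulr_natl.
Qed.

Section GateBounds.
Variables (R : realType) (xi kappa : nat).
Hypothesis xi_gt0 : (0 < xi)%N.
Hypothesis kappa_le : (kappa <= xi)%N.
Local Notation G := (clifford_class R (2 * xi)).

(** Trivial syndrome on one region; a uniform string satisfies it with probability [decay], since
    two of the four letters have no X-part. *)
Definition ancillas_ok (u : pstring xi) : bool :=
  [forall a : 'I_xi, (kappa <= a)%N ==> ~~ xbit (u a)].

Definition decay : R := 2^-1 ^+ (xi - kappa).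

Lemma decay_gt0 : 0 < decay. Proof. by rewrite exprn_gt0 // invr_gt0. Qed.
Lemma decay_le1 : decay <= 1.
Proof. by rewrite exprn_ile1 ?invr_ge0 // invf_le1 // ler1n. Qed.

Lemma sum_ancillas_ok : \sum_u (ancillas_ok u)%:R = (4 ^ xi)%:R * decay.
Proof.
pose F (a : 'I_xi) (b : 'I_4) : R := if (kappa <= a)%N then (~~ xbit b)%:R else 1.
have -> : \sum_u (ancillas_ok u)%:R = \sum_(u : pstring xi) \prod_a F a (u a).
  apply: eq_bigr => u _; rewrite /ancillas_ok; case: forallP => [h|h].
    rewrite big1 // => a _; rewrite /F; case: ifP => // ka.
    by have := h a; rewrite ka /= => ->.
  have [a] : exists a : 'I_xi, ~~ ((kappa <= a)%N ==> ~~ xbit (u a)).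
    by apply/existsP; apply: contraT => /existsPn h'; case: h => a; have := h' a; rewrite negbK.
  by rewrite negb_imply negbK => /andP [ka xa]; rewrite (bigD1 a) //= /F ka xa mul0r.
rewrite -(bigA_distr_bigA F).
have -> : \prod_a \sum_b F a b = \prod_(a < xi) (4 * (if (kappa <= a)%N then 2^-1 else 1)).
  apply: eq_bigr => a _; rewrite !big_ord_recl big_ord0 /F.
  by case: ifP => _ /=; rewrite /xbit /=; lra.
rewrite big_split /= prodr_const card_ord natrX; congr (_ * _).
rewrite -big_mkcond -(big_geq_mkord kappa xi xpredT (fun=> 2^-1)).
by rewrite prodr_const_nat.
Qed.

(** A non-identity v is averaged by the gate to at most s^2, where s bounds the uniform mean of phi.
    This must be paid for by one factor rho if v is non-identity on one region and by two if on
    both, hence the two hypotheses on s^2. It is used with (s, rho) = (t, t) and (2t, 4t). *)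
Lemma gate_average (phi : pstring xi -> R) (s rho : R) (v : pstring (2 * xi)) :
  (forall u, 0 <= phi u <= 1) -> phi pone = 1 ->
  \sum_u phi u <= (4 ^ xi)%:R * s -> 0 <= rho -> s ^+ 2 <= rho -> s ^+ 2 <= rho ^+ 2 ->
  \sum_(x : G) \prod_(r < 2) phi (region xi r (clifford_pull x v)) <=
    #|{: G}|%:R * \prod_(r < 2) rho ^+ (region xi r v != pone).
Proof.
move=> phi01 phi1 phis rho0 h1 h2.
have [->|v0] := eqVneq v pone.
  rewrite (eq_bigr (fun=> 1)) => [|x _]; last first.
    by rewrite pull_pone big1 // => r _; rewrite region_pone.
  by rewrite sumr_const [X in _ <= _ * X]big1 ?mulr1 // => r _; rewrite region_pone eqxx.
pose f (w : pstring (2 * xi)) := \prod_(r < 2) phi (region xi r w).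
have K0 : 0 < (4 ^ (2 * xi))%:R :> R by rewrite ltr0n expn_gt0.
have sum0 : 0 <= \sum_u phi u by apply: sumr_ge0 => u _; case/andP: (phi01 u).
have avg := @pull_average R (2 * xi) f v v0.
rewrite -(ler_pM2l K0); apply: le_trans (avg _) _ => [w|].
  have -> : f pone = 1 by rewrite /f big1 // => r _; rewrite region_pone.
  have : \prod_(r < 2) phi (region xi r w) <= \prod_(r < 2) 1.
    by apply: ler_prod => r _; exact: phi01.
  by rewrite big1_eq.
rewrite mulrCA; apply: ler_wpM2l => //.
rewrite /f (sum_regions xi_gt0 (fun=> phi)) // prodr_const card_ord.
have -> : (4 ^ (2 * xi))%:R = ((4 ^ xi)%:R : R) ^+ 2 by rewrite mulnC expnM natrX.
apply: (@le_trans _ _ (((4 ^ xi)%:R * s) ^+ 2)).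
  by rewrite lerXn2r // ?nnegrE // (le_trans sum0).
rewrite exprMn; apply: ler_wpM2l; first by rewrite exprn_ge0.
rewrite !big_ord_recl big_ord0 mulr1 /=.
have [r0|r0] := eqVneq (region xi 0 v) pone; have [r1|r1] := eqVneq (region xi (bump 0 0) v) pone;
  rewrite /= ?expr0 ?expr1 ?mul1r ?mulr1 //.
case/eqP: v0; apply: (region_eq_pone xi_gt0 (erefl _)) => -[[|[|//]] hr] //.
Qed.

End GateBounds.

Section CircuitBounds.
Variables (R : realType) (n xi kappa : nat).
Hypothesis xi_gt0 : (0 < xi)%N.
Hypothesis kappa_le : (kappa <= xi)%N.
Let M := (n %/ xi).-1.
Hypothesis n_eq : n = (M.+1 * xi)%N.
Hypothesis odd_M : odd M.
Local Notation G := (clifford_class R (2 * xi)).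
Local Notation t := (decay R xi kappa).
Implicit Types (g : {ffun 'I_M -> G}) (w : pstring n).

Let pulls g := fun j => @clifford_pull R (2 * xi) (g j).

Lemma eq_layer (act act' : 'I_M -> pstring (2 * xi) -> pstring (2 * xi)) (r : seq 'I_M) w :
  (forall j, j \in r -> act j = act' j) -> layer act r w = layer act' r w.
Proof.
elim: r w => //= j r IH w h.
rewrite /layer /= -!/(layer _ _ _) IH => [|i ir]; last by apply: h; rewrite inE ir orbT.
by rewrite /gate_step h // inE eqxx.
Qed.

Lemma layer_window b g w (j : 'I_M) : odd j = b ->
  win ord0 (2 * xi) (j * xi) (layer (pulls g) (gates n xi b) w) =
  clifford_pull (g j) (win ord0 (2 * xi) (j * xi) w).
Proof.
move=> ob; rewrite (@layer_gate _ _ _ _ _ b) // ?filter_uniq ?index_enum_uniq //.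
- by rewrite -n_eq.
- by move=> i; rewrite mem_filter => /andP [/eqP].
- by rewrite mem_filter ob eqxx mem_index_enum.
Qed.

Lemma gate_region w (j : 'I_M) (r : 'I_2) :
  region xi r (win ord0 (2 * xi) (j * xi) w) = region xi (j + r) w.
Proof. by apply: region_win; rewrite leq_mul2r orbC ltn_ord. Qed.

Lemma prod_gate_region (f : pstring xi -> R) w (j : 'I_M) :
  \prod_(r < 2) f (region xi r (win ord0 (2 * xi) (j * xi) w)) =
  f (region xi j w) * f (region xi j.+1 w).
Proof.
under eq_bigr => r _ do rewrite gate_region.
by rewrite !big_ord_recl big_ord0 mulr1 /= addn0 addn1.
Qed.

(** The ancilla condition splits over the pairs of regions of the even gates, each pair being an
    instance of [gate_average] with s = rho = t. *)
Lemma even_layer_bound w :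
  \sum_(g : {ffun 'I_M -> G}) ([forall r : 'I_M.+1,
      ancillas_ok kappa (region xi r (layer (pulls g) (gates n xi false) w))])%:R <=
  #|{: {ffun 'I_M -> G}}|%:R * \prod_(r < M.+1) t ^+ (region xi r w != pone).
Proof.
have t0 := decay_gt0 R xi kappa; have t1 := decay_le1 R xi kappa.
pose e (j : 'I_M) (x : G) : R :=
  \prod_(r < 2) (ancillas_ok kappa (region xi r (clifford_pull x (win ord0 (2 * xi) (j * xi) w))))%:R.
rewrite -(prod_even_pairs (fun r => t ^+ (region xi r w != pone)) odd_M).
apply: (@le_trans _ _ (\sum_(g : {ffun 'I_M -> G}) \prod_(j < M | ~~ odd j) e j (g j))).
  apply: ler_sum => g _; case: forallP => [h|_]; last first.
    by apply: prodr_ge0 => j _; apply: prodr_ge0.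
  rewrite big1 // => j /negbTE oj; rewrite /e big1 // => r _.
  rewrite -(layer_window g w oj) gate_region.
  have lt : (j + r < M.+1)%N by have := ltn_ord j; have := ltn_ord r; lia.
  by have := h (Ordinal lt) => /= ->.
apply: sum_gates_le => [j x _|j _]; first by apply: prodr_ge0.
rewrite -(prod_gate_region (fun u => t ^+ (u != pone))).
apply: (@gate_average R xi xi_gt0 (fun u => (ancillas_ok kappa u)%:R) t) => //.
- by move=> u; case: ancillas_ok; rewrite lexx ler01.
- rewrite (_ : ancillas_ok kappa pone) //.
  by apply/forallP => a; rewrite ffunE implybT.
- by rewrite sum_ancillas_ok.
- exact: ltW.
- by rewrite expr2 ler_piMr // ltW.
Qed.

(** The uniform mean of t^[u <> 1] on a region is at most t + 4^-xi <= 2t, so s = 2t, and rho = 4t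
    dominates since 4t^2 <= 4t and 4t^2 <= 16t^2. The two end regions keep their factor, as t <=
    4t. *)
Lemma odd_layer_bound w :
  \sum_(g : {ffun 'I_M -> G}) \prod_(r < M.+1) t ^+ (region xi r (layer (pulls g) (gates n xi true) w) != pone) <=
  #|{: {ffun 'I_M -> G}}|%:R * \prod_(r < M.+1) (4 * t) ^+ (region xi r w != pone).
Proof.
have t0 := decay_gt0 R xi kappa; have t1 := decay_le1 R xi kappa.
pose lay g := layer (pulls g) (gates n xi true) w.
pose e (j : 'I_M) (x : G) : R :=
  \prod_(r < 2) t ^+ (region xi r (clifford_pull x (win ord0 (2 * xi) (j * xi) w)) != pone).
(* An odd gate starts at region 1 or later and, as M is odd, ends before region M. *)
have ends r g : (r == 0%N) || (r == M) -> region xi r (lay g) = region xi r w.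
  move=> hr; apply: layer_disjoint => j; rewrite mem_filter => /andP [/eqP oj _].
  have jM := ltn_ord j; have j0 : (0 < j)%N by case: (nat_of_ord j) oj.
  have jM1 : (j.+1 < M)%N by rewrite ltn_neqAle jM andbT; apply: contraTneq odd_M => <-; rewrite /= oj.
  case/orP: hr => /eqP ->; apply/orP; [left|right].
    by rewrite mul0n add0n leq_pmull.
  by rewrite -mulnDl leq_mul2r addn2 jM1 orbT.
pose h r := t ^+ (region xi r w != pone); pose h' r := (4 * t) ^+ (region xi r w != pone).
have h0 r : 0 <= h r by rewrite exprn_ge0 // ltW.
have h'0 r : 0 <= h' r by rewrite exprn_ge0 // mulr_ge0 // ltW.
have hh' r : h r <= h' r by rewrite /h /h'; case: (_ != _); rewrite ?expr0 ?expr1 ?ler_peMl ?ler1n // ltW.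
have -> : \sum_(g : {ffun 'I_M -> G}) \prod_(r < M.+1) t ^+ (region xi r (lay g) != pone) =
    h 0%N * (\sum_(g : {ffun 'I_M -> G}) \prod_(j < M | odd j) e j (g j)) * h M.
  rewrite mulr_sumr mulr_suml; apply: eq_bigr => g _.
  rewrite -(prod_odd_pairs (fun r => t ^+ (region xi r (lay g) != pone)) odd_M).
  rewrite !ends ?eqxx ?orbT // -/(h 0%N) -/(h M); congr (_ * _ * _).
  apply: eq_bigr => j oj.
  by rewrite /e -(layer_window g w oj) (prod_gate_region (fun u => t ^+ (u != pone))).
rewrite -(prod_odd_pairs h' odd_M).
rewrite [X in _ <= X](_ : _ = h' 0%N * (#|{: {ffun 'I_M -> G}}|%:R *
  \prod_(j < M | odd j) (h' j * h' j.+1)) * h' M); last by ring.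
have S0 : 0 <= \sum_(g : {ffun 'I_M -> G}) \prod_(j < M | odd j) e j (g j).
  apply: sumr_ge0 => g _; apply: prodr_ge0 => j _; apply: prodr_ge0 => r _.
  by rewrite exprn_ge0 // ltW.
apply: ler_pM => //; [by rewrite mulr_ge0|apply: ler_pM => //].
apply: sum_gates_le => [j x _|j _].
  by apply: prodr_ge0 => r _; rewrite exprn_ge0 // ltW.
rewrite -(prod_gate_region (fun u => (4 * t) ^+ (u != pone))).
apply: (@gate_average R xi xi_gt0 (fun u => t ^+ (u != pone)) (2 * t)) => //.
- by move=> u; case: (_ != _); rewrite ?expr0 ?expr1 ?lexx ?ler01 // t1 ltW.
- by rewrite eqxx.
- rewrite (bigD1 pone) //= eqxx expr0.
  under eq_bigr => u u0 do rewrite u0 expr1.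
  rewrite sum_nonid.
  (* This is 4^-xi <= t, true since a region has at most 2 xi ancillas. *)
  suff : 1 <= (4 ^ xi)%:R * t by lra.
  have -> : (4 ^ xi)%:R = (2 ^ (xi + xi))%:R :> R by rewrite addnn -mul2n expnM.
  rewrite natrX -lter_pdivrMr // div1r /decay exprVn invrK.
  by apply: ler_weXn2l; [rewrite ler1n|lia].
- by rewrite mulr_ge0 // ltW.
- have : t ^+ 2 <= t by rewrite expr2 ler_piMr // ltW.
  by rewrite exprMn; lra.
- by rewrite !exprMn; apply: ler_wpM2r; [rewrite exprn_ge0 // ltW|rewrite -!natrX ler_nat].
Qed.

(** Splicing odd gates from g with even gates from g', the sum over g' is bounded first, with the
    string leaving the odd layer fixed, and then the sum over g. *)
Lemma circuit_bound w :
  \sum_(g : {ffun 'I_M -> G}) ([forall r : 'I_M.+1,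
      ancillas_ok kappa (region xi r (circuit_action g w))])%:R <=
  #|{: {ffun 'I_M -> G}}|%:R * \prod_(r < M.+1) (4 * t) ^+ (region xi r w != pone).
Proof.
have [K0|K0] := posnP #|{: {ffun 'I_M -> G}}|.
  by rewrite K0 mul0r big1 // => g; have := card0_eq K0 g; rewrite inE.
have K0' : 0 < #|{: {ffun 'I_M -> G}}|%:R :> R by rewrite ltr0n.
rewrite -(ler_pM2l K0') (sum_mix (fun j : 'I_M => odd j)).
apply: (@le_trans _ _ (\sum_(g : {ffun 'I_M -> G}) #|{: {ffun 'I_M -> G}}|%:R *
    \prod_(r < M.+1) t ^+ (region xi r (layer (pulls g) (gates n xi true) w) != pone))); last first.
  by rewrite -mulr_sumr; apply: ler_wpM2l; [exact: ltW | exact: odd_layer_bound].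
apply: ler_sum => g _; apply: le_trans (even_layer_bound _).
apply: ler_sum => g' _; rewrite le_eqVlt; apply/orP; left; apply/eqP.
congr (nat_of_bool _)%:R; apply: eq_forallb => r; congr (ancillas_ok _ (region _ _ _)).
rewrite /circuit_action.
refine (etrans (eq_layer (act' := pulls g') _ _) (congr1 _ (eq_layer _ _))) => j;
  by rewrite mem_filter => /andP [/eqP oj _]; rewrite /pulls ffunE oj.
Qed.

End CircuitBounds.

(** * The average failure probability *)

Section AverageFailure.
Variables (R : realType) (p : 'I_4 -> R).
Hypothesis p_prob : prob_vector p.

Lemma pweight_ge0 m (w : pstring m) : 0 <= pweight p w.
Proof. by apply: prodr_ge0 => q _; case: p_prob. Qed.

Lemma sum_pweight m : \sum_(w : pstring m) pweight p w = 1.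
Proof.
rewrite /pweight -(bigA_distr_bigA (fun (q : 'I_m) b => p b)).
by rewrite big1 // => q _; case: p_prob.
Qed.

Variables (n k xi : nat).
Hypothesis xi_gt0 : (0 < xi)%N.
Let M := (n %/ xi).-1.
Let kappa := (k * xi %/ n)%N.
Hypothesis n_eq : n = (M.+1 * xi)%N.
Hypothesis k_eq : k = (M.+1 * kappa)%N.
Hypothesis odd_M : odd M.
Hypothesis kappa_le : (kappa <= xi)%N.
Local Notation G := (clifford_class R (2 * xi)).
Local Notation K := (#|{: {ffun 'I_M -> G}}|%:R : R).
Variable T0 : {set pstring xi}.

Lemma pweight_regions (w : pstring n) :
  pweight p w = \prod_(r < M.+1) pweight p (region xi r w).
Proof. exact: prod_regions. Qed.

(** Typicality in every region separately, rather than of the whole weight, makes the sum over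
    collisions factorize. *)
Definition typical : {set pstring n} :=
  [set w | [forall r : 'I_M.+1, region xi r w \in T0]]%SET.

Lemma sum_atypical :
  \sum_(w | w \notin typical) pweight p w <=
  M.+1%:R * \sum_(u | u \notin T0) pweight p u.
Proof.
have -> : M.+1%:R * \sum_(u | u \notin T0) pweight p u =
    \sum_(r < M.+1) \sum_(w : pstring n) pweight p w * (region xi r w \notin T0)%:R.
  rewrite mulr_natl -[in LHS](card_ord M.+1) -sumr_const; apply: eq_bigr => r _.
  pose phi (r' : 'I_M.+1) u := pweight p u * (if r' == r then (u \notin T0)%:R else 1).
  transitivity (\prod_(r' < M.+1) \sum_(u : pstring xi) phi r' u).
    rewrite (bigD1 r) //= [X in _ * X]big1 ?mulr1 => [|r' rr'].
      rewrite big_mkcond; apply: eq_bigr => u _; rewrite /phi eqxx.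
      by case: (u \notin T0); rewrite ?mulr1 ?mulr0.
    by rewrite -[RHS](sum_pweight xi); apply: eq_bigr => u _; rewrite /phi (negbTE rr') mulr1.
  rewrite -(sum_regions xi_gt0 phi n_eq); apply: eq_bigr => w _.
  rewrite /phi big_split /= -pweight_regions (bigD1 r) //= eqxx big1 ?mulr1 //.
  by move=> r' /negbTE ->.
rewrite exchange_big big_mkcond /=; apply: ler_sum => w _.
rewrite -mulr_sumr; case: ifP => [|_]; last by rewrite mulr_ge0 ?pweight_ge0 ?sumr_ge0.
rewrite inE negb_forall => /existsP [r hr].
rewrite -[leLHS]mulr1; apply: ler_wpM2l; first exact: pweight_ge0.
by rewrite (bigD1 r) //= hr lerDl sumr_ge0.
Qed.

(** Over all typical v the sum is a product over regions: in each, the choice equal to w contributes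
    at most 1 and the others at most |T0| th. The subtracted 1 is the term v = w. *)
Lemma sum_collisions (th : R) (w : pstring n) : 0 <= th -> w \in typical ->
  \sum_(v in typical | v != w)
     \prod_(r < M.+1) th ^+ (region xi r (pmul v w) != pone) <=
  (1 + #|T0|%:R * th) ^+ M.+1 - 1.
Proof.
move=> th0 wT; pose phi (r : 'I_M.+1) u : R :=
  (u \in T0)%:R * th ^+ (u != region xi r w).
rewrite lerBrDr.
have -> : \sum_(v in typical | v != w)
     \prod_(r < M.+1) th ^+ (region xi r (pmul v w) != pone) + 1 =
   \sum_(v : pstring n) \prod_(r < M.+1) phi r (region xi r v).
  rewrite addrC [RHS](bigID (fun v => v \in typical)) /= [X in _ = _ + X]big1 ?addr0; last first.
    move=> v vT; have /existsP [r hr] : [exists r : 'I_M.+1, region xi r v \notin T0].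
      by rewrite -negb_forall; move: vT; rewrite inE.
    by rewrite (bigD1 r) //= /phi (negbTE hr) !mul0r.
  have E v : v \in typical -> \prod_(r < M.+1) phi r (region xi r v) =
      \prod_(r < M.+1) th ^+ (region xi r (pmul v w) != pone).
    rewrite inE => /forallP hv; apply: eq_bigr => r _.
    by rewrite /phi hv mul1r region_pmul pmul_eq1.
  rewrite [in RHS](bigD1 w) //= E // pmulww; congr (_ + _).
    by rewrite big1 // => r _; rewrite region_pone eqxx.
  by apply: eq_bigr => v /andP [vT _]; rewrite E.
rewrite (sum_regions xi_gt0 phi n_eq) -[in leRHS](card_ord M.+1) -prodr_const.
apply: ler_prod => r _; apply/andP; split.
  by apply: sumr_ge0 => u _; rewrite mulr_ge0 ?exprn_ge0.
rewrite (bigD1 (region xi r w)) //= {1}/phi eqxx mulr1; apply: lerD.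
  by case: (_ \in T0); rewrite ?lexx ?ler01.
rewrite -sum1_card natr_sum mulr_suml big_mkcond [leRHS]big_mkcond /=.
apply: ler_sum => u _; rewrite /phi; case: eqVneq => _ /=.
  by case: (u \in T0); rewrite // mul1r.
by case: (u \in T0); rewrite ?mul0r ?mul1r.
Qed.

Lemma circuit_action_pmul (g : {ffun 'I_M -> G}) (v w : pstring n) :
  circuit_action g (pmul v w) = pmul (circuit_action g v) (circuit_action g w).
Proof.
have hM : (M.+1 * xi <= n)%N by rewrite -n_eq.
apply: conjugates_pmul (circuit_conjugates hM g) v w.
by rewrite trmxC_unitary circuit_unitary.
Qed.

Lemma syndrome_ancillas_ok (v w : pstring n) :
  syndrome k xi v = syndrome k xi w ->
  [forall r : 'I_M.+1, ancillas_ok kappa (region xi r (pmul v w))].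
Proof.
move=> h; apply/forallP => r; apply/forallP => a; apply/implyP => ka.
have lt : (r * xi + a < n)%N by rewrite [X in (_ < X)%N]n_eq region_index.
rewrite /region (winE _ _ lt) ffunE /pmul1 xbit_of_xz.
have := congr1 (fun f : qubits n => f (Ordinal lt)) h; rewrite !ffunE /=.
by rewrite modnMDl modn_small // ka /= => ->; rewrite addbb.
Qed.

Local Notation tau g := (@circuit_action R n xi g).
Local Notation correct g := (@correctable n k xi (tau g) typical).
Local Notation th := (4 * decay R xi kappa).

Definition failure_bound : R :=
  M.+1%:R * (\sum_(u | u \notin T0) pweight p u) +
  ((1 + #|T0|%:R * th) ^+ M.+1 - 1).

(** A typical error fails only if another typical v has its syndrome; then the pull-back of vw has
    no X-part on the ancillas, and such v are counted by the union bound. *)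
Lemma failure_split (g : {ffun 'I_M -> G}) :
  1 - \sum_(w | correct g w) pweight p w <=
  \sum_(w | w \notin typical) pweight p w +
  \sum_(w in typical) pweight p w * \sum_(v in typical | v != w)
    ([forall r : 'I_M.+1, ancillas_ok kappa (region xi r (tau g (pmul v w)))])%:R.
Proof.
have -> : 1 - \sum_(w | correct g w) pweight p w = \sum_(w | ~~ correct g w) pweight p w.
  apply/eqP; rewrite subr_eq addrC; apply/eqP.
  by rewrite -[LHS](sum_pweight n) [LHS](bigID (correct g)).
rewrite [leLHS](bigID (fun w => w \in typical)) /= [leLHS]addrC; apply: lerD.
  rewrite [leLHS]big_mkcond [leRHS]big_mkcond /=; apply: ler_sum => w _.
  by case: (w \notin typical); rewrite ?andbT ?andbF // ; case: ifP => // _; exact: pweight_ge0.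
rewrite [leLHS]big_mkcond [leRHS]big_mkcond /=; apply: ler_sum => w _.
have [wT|_] := boolP (w \in typical); rewrite ?andbF // andbT.
have S0 : 0 <= \sum_(v in typical | v != w)
    ([forall r : 'I_M.+1, ancillas_ok kappa (region xi r (tau g (pmul v w)))])%:R :> R.
  exact: sumr_ge0.
case: ifP => [|_]; last first.
  apply: mulr_ge0; [exact: pweight_ge0 | exact: S0].
rewrite /correctable wT /= negb_forall => /existsP [v].
rewrite !negb_imply => /andP [vT /andP [/eqP sv vw]].
rewrite -[leLHS]mulr1; apply: ler_wpM2l; first exact: pweight_ge0.
rewrite (bigD1 v) /=; last by rewrite vT.
rewrite circuit_action_pmul syndrome_ancillas_ok // lerDl.
exact: sumr_ge0.
Qed.

Lemma average_failure :
  \sum_(g : {ffun 'I_M -> G}) (1 - \sum_(w | correct g w) pweight p w) <=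
  K * failure_bound.
Proof.
have th0 : 0 <= th by rewrite mulr_ge0 // ltW // decay_gt0.
apply: (@le_trans _ _ (\sum_(g : {ffun 'I_M -> G})
  (\sum_(w | w \notin typical) pweight p w +
  \sum_(w in typical) pweight p w * \sum_(v in typical | v != w)
    ([forall r : 'I_M.+1, ancillas_ok kappa (region xi r (tau g (pmul v w)))])%:R))).
  by apply: ler_sum => g _; exact: failure_split.
rewrite big_split /= sumr_const -[X in X + _ <= _]mulr_natl /failure_bound mulrDr; apply: lerD.
  by apply: ler_wpM2l => //; exact: sum_atypical.
rewrite exchange_big /=.
apply: (@le_trans _ _ (\sum_(w in typical) pweight p w * (K * ((1 + #|T0|%:R * th) ^+ M.+1 - 1)))).
  apply: ler_sum => w wT; rewrite -mulr_sumr; apply: ler_wpM2l; first exact: pweight_ge0.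
  rewrite exchange_big /=; apply: le_trans (ler_wpM2l _ (sum_collisions th0 wT)) => //.
  rewrite mulr_sumr; apply: ler_sum => v _.
  exact: circuit_bound.
have B0 : 0 <= K * ((1 + #|T0|%:R * th) ^+ M.+1 - 1).
  by rewrite mulr_ge0 // subr_ge0 exprn_ege1 // lerDl mulr_ge0.
rewrite -mulr_suml ler_piMl // -(sum_pweight n) [leRHS](bigID (fun w => w \in typical)) /=.
by rewrite lerDl sumr_ge0 // => w _; exact: pweight_ge0.
Qed.

Lemma average_choi_error (s : R) : 0 < s -> failure_bound <= s ^+ 2 ->
  \sum_(g : {ffun 'I_M -> G}) choi_error (pauli_noise p
       \o @encoding R n k xi (@blocked_circuit R n xi (fun j => clifford_mx (g j)))) <=
  K * s.
Proof.
move=> s0 hB; have hM : (M.+1 * xi <= n)%N by rewrite -n_eq.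
pose a g := 1 - \sum_(w | correct g w) pweight p w.
have a0 g : 0 <= a g.
  rewrite subr_ge0 -(sum_pweight n) [leRHS](bigID (correct g)) /= lerDl.
  by apply: sumr_ge0 => w _; exact: pweight_ge0.
(* Jensen for the square root, through its tangent at s^2: sqrt(a) <= (a/s + s)/2. *)
apply: (@le_trans _ _ (\sum_(g : {ffun 'I_M -> G}) (a g / s + s) / 2)).
  apply: ler_sum => g _.
  apply: le_trans (choi_error_correctable xi_gt0 n_eq k_eq kappa_le
    (circuit_unitary hM g) (circuit_conjugates hM g) typical (proj1 p_prob)) _.
  rewrite -/(a g); have := sqr_sqrtr (a0 g); move: (Num.sqrt (a g)) => x <-.
  rewrite -(ler_pM2r s0) mulrAC mulrDl divfK ?gt_eqF // ler_pdivlMr //.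
  by rewrite -subr_ge0 (_ : _ - _ = (x - s) ^+ 2) ?sqr_ge0 //; ring.
rewrite -mulr_suml big_split /= sumr_const -mulr_suml.
have := average_failure; rewrite -/(a _) => hA.
have : (\sum_(g : {ffun 'I_M -> G}) a g) / s <= K * s.
  by rewrite ler_pdivrMr // -mulrA -expr2; apply: le_trans hA (ler_wpM2l _ hB).
by rewrite -[s *+ _]mulr_natl; lra.
Qed.

End AverageFailure.

(** * Asymptotics *)

Section Asymptotics.
Variable R : realType.

(** From exp(y)(1 - y) <= exp(y) exp(-y) = 1, as 1 <= (1 + y + 2y^2)(1 - y) for y <= 1/2. *)
Lemma expR_le_quad (y : R) : y <= 2^-1 -> expR y <= 1 + y + 2 * y ^+ 2.
Proof.
move=> hy; have y1 : 0 < 1 - y by lra.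
rewrite -(ler_pM2r y1); apply: (@le_trans _ _ 1).
  rewrite -[leRHS](expRxMexpNx_1 y); apply: ler_wpM2l; first exact: expR_ge0.
  exact: expR_ge1Dx.
have -> : (1 + y + 2 * y ^+ 2) * (1 - y) = 1 + y ^+ 2 * (1 - 2 * y) by ring.
by rewrite lerDl mulr_ge0 ?sqr_ge0 //; lra.
Qed.

Section Chernoff.
Variables (p : 'I_4 -> R) (a : R).
Hypothesis p_prob : prob_vector p.
Hypothesis a_gt : - \sum_w p w * ln (p w) < a.

(** Exponential Markov inequality: x = -ln p - a has mean -e < 0 and |x| <= X, so its moment
    generating function at a small s > 0 is at most 1 - s e + 2 s^2 X^2 < 1. Entropies are in nats
    here, and q does not depend on xi. *)
Lemma chernoff : exists2 q : R, 0 <= q < 1 & forall xi,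
  \sum_(u : pstring xi | pweight p u < expR (- (xi%:R * a))) pweight p u <= q ^+ xi.
Proof.
have [p0 p1] := p_prob.
pose x w := - ln (p w) - a; pose X := 1 + \sum_w `|x w|; pose e := - \sum_w p w * x w.
have e0 : 0 < e.
  have -> : e = a - - \sum_w p w * ln (p w).
    rewrite /e /x; under eq_bigr do rewrite mulrBr mulrN.
    by rewrite big_split /= !sumrN -mulr_suml p1 mul1r; ring.
  by rewrite subr_gt0.
have X1 : 1 <= X by rewrite lerDl sumr_ge0.
have xX w : `|x w| <= X by rewrite /X (bigD1 w) //= addrCA lerDl addr_ge0 ?sumr_ge0.
have eX : 0 < e + X by lra.
have eX2 : 0 < (e + X) ^+ 2 by rewrite exprn_gt0.
(* small enough that s x <= 1/2 and 2 s^2 X^2 < s e *)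
pose s := e / (2 * (e + X) ^+ 2).
have s0 : 0 < s by rewrite divr_gt0 // mulr_gt0.
have sE : s * (2 * (e + X) ^+ 2) = e by rewrite /s divfK // gt_eqF // mulr_gt0.
have sx w : s * x w <= 2^-1.
  have h1 : s * x w <= s * X by rewrite ler_pM2l // (le_trans (ler_norm _)).
  apply: (le_trans h1); rewrite -(ler_pM2r eX2).
  have -> : s * X * (e + X) ^+ 2 = 2^-1 * (e * X) by rewrite -{2}sE; field.
  by rewrite ler_pM2l ?invr_gt0 //; nra.
pose q := \sum_w p w * expR (s * x w).
have q0 : 0 <= q by apply: sumr_ge0 => w _; rewrite mulr_ge0 ?expR_ge0.
have q1 : q < 1.
  apply: (@le_lt_trans _ _ (\sum_w p w * (1 + s * x w + 2 * s ^+ 2 * X ^+ 2))).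
    apply: ler_sum => w _; apply: ler_wpM2l => //; apply: (le_trans (expR_le_quad (sx w))).
    rewrite lerD2l exprMn mulrA; apply: ler_wpM2l; first by rewrite mulr_ge0 ?sqr_ge0.
    by rewrite -[leLHS]real_normK ?num_real // lerXn2r ?nnegrE //; lra.
  have -> : \sum_w p w * (1 + s * x w + 2 * s ^+ 2 * X ^+ 2) =
      1 - s * e + 2 * s ^+ 2 * X ^+ 2.
    transitivity (\sum_w (p w * (1 + 2 * s ^+ 2 * X ^+ 2) + s * (p w * x w))).
      by apply: eq_bigr => w _; ring.
    by rewrite big_split /= -mulr_suml p1 -mulr_sumr -[\sum_w p w * x w]opprK -/e; ring.
  have h : 2 * s ^+ 2 * X ^+ 2 < s * e.
    have -> : 2 * s ^+ 2 * X ^+ 2 = s * (s * (2 * X ^+ 2)) by ring.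
    rewrite ltr_pM2l // -[ltRHS]sE ltr_pM2l // ltr_pM2l // ltrXn2r ?nnegrE //; lra.
  by lra.
exists q => [|xi]; first by rewrite q0.
pose f (w : 'I_4) := p w * expR (s * x w).
have -> : q ^+ xi = \sum_(u : pstring xi) \prod_i f (u i).
  by rewrite -(bigA_distr_bigA (fun (i : 'I_xi) w => f w)) prodr_const card_ord.
rewrite big_mkcond; apply: ler_sum => u _.
have f0 : 0 <= \prod_i f (u i) by apply: prodr_ge0 => i _; rewrite mulr_ge0 ?expR_ge0.
case: ifP => // hu.
(* Strings of weight 0 contribute nothing; in the others every letter has positive probability, so
   exp undoes ln. *)
have [pu0|pu0] := eqVneq (pweight p u) 0; first by rewrite pu0.
have pu i : 0 < p (u i).
  by rewrite lt_neqAle p0 andbT eq_sym; move: pu0; rewrite /pweight prodf_seq_neq0 => /allP /(_ i);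
     rewrite mem_index_enum => /(_ isT).
rewrite /f big_split /= -/(pweight p u) -[leLHS]mulr1; apply: ler_wpM2l.
  by rewrite prodr_ge0.
rewrite -expR_sum -mulr_sumr -expR0 ler_expR mulr_ge0 ?(ltW s0) //.
rewrite /x big_split /= !sumrN sumr_const card_ord -mulr_natl.
suff : \sum_i ln (p (u i)) < - (xi%:R * a) by lra.
rewrite -ltr_expR expR_sum; apply: le_lt_trans hu.
by rewrite /pweight; apply: ler_prod => i _; rewrite expR_ge0 lnK ?posrE //=.
Qed.

End Chernoff.

(** * Vanishing of the expected error for admissible parameters *)

Section Admissible.
Variables (n k : nat) (eps : R).
Hypothesis adm : admissible n k eps.
Let xi := region_size n eps.
Let kappa := (k * xi %/ n)%N.

(** The divisibility of n by 2 xi makes the number of regions even, hence the number of gates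
    odd. *)
Lemma admissible_arith : [/\ (0 < n)%N, (0 < xi)%N, n = ((n %/ xi).-1.+1 * xi)%N,
  k = ((n %/ xi).-1.+1 * kappa)%N & odd (n %/ xi).-1 /\ (kappa <= xi)%N].
Proof.
case: adm => n0 kn e0 xi0 [_ dv1 dv2].
have xn : (xi %| n)%N by apply: dvdn_trans dv1; rewrite dvdn_mull.
have c0 : (0 < n %/ xi)%N by rewrite divn_gt0 // dvdn_leq.
have kE : (k * xi = kappa * n)%N by rewrite /kappa divnK.
have nE : n = (n %/ xi * xi)%N by rewrite divnK.
rewrite prednK //; split=> //.
  apply/eqP; rewrite -(eqn_pmul2r xi0) kE {1}nE; apply/eqP; lia.
split; last by rewrite -(leq_pmul2r n0) -kE mulnC leq_mul2l kn orbT.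
case/dvdnP: dv1 => m hm.
have -> : (n %/ xi = 2 * m)%N by rewrite hm mulnCA mulnA mulnK // mulnC.
have m0 : (0 < m)%N by case: m hm n0 => // ->.
by case: m m0 {hm} => // m _; rewrite mulnS addSn /= oddD oddM.
Qed.

Lemma log_region : (xi%:R : R) = log2 (n%:R / eps).
Proof. by case: adm => _ _ _ _ []. Qed.

Lemma ancilla_count : ((xi - kappa)%N%:R : R) = xi%:R * (1 - k%:R / n%:R).
Proof.
case: admissible_arith => n0 _ _ _ [_ kx].
case: adm => _ _ _ _ [_ _ dv2].
have kE : (k * xi = kappa * n)%N by rewrite /kappa divnK.
have nn0 : (n%:R : R) != 0 by rewrite pnatr_eq0 -lt0n.
rewrite natrB // mulrBr mulr1; congr (_ - _).
apply: (mulIf nn0); rewrite -natrM -kE natrM; field => //.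
Qed.

Variable p : 'I_4 -> R.
Hypothesis p_prob : prob_vector p.

Lemma expected_le (T0 : {set pstring xi}) (s : R) : 0 < s ->
  failure_bound p n k T0 <= s ^+ 2 -> expected_choi_error p n k eps <= s.
Proof.
move=> s0 hB; case: admissible_arith => n0 x0 nE kE [oM kx].
have := average_choi_error p_prob x0 nE kE oM kx s0 hB.
rewrite /expected_choi_error -/xi => hS.
(* An empty family would give mean 0, by the convention on division by 0. *)
have [->|K0] := posnP #|{: {ffun 'I_(n %/ xi).-1 -> clifford_class R (2 * xi)}}|.
  by rewrite invr0 mulr0 ltW.
by rewrite ler_pdivrMr ?ltr0n // mulrC.
Qed.

End Admissible.

Lemma ln2_gt0 : 0 < ln 2 :> R. Proof. by rewrite ln_gt0 // ltr1n. Qed.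

Lemma entropyE (p : 'I_4 -> R) : entropy p * ln 2 = - \sum_w p w * ln (p w).
Proof.
rewrite /entropy mulNr; congr (- _); rewrite mulr_suml; apply: eq_bigr => w _.
by rewrite /log2 mulrA divfK // gt_eqF // ln2_gt0.
Qed.

(** The slack 2d is shared: d defines typicality, and the other d is left as the decay rate 2^(-d
    xi) of |T0| t. The power is then controlled by 1 + P <= exp P. *)
Lemma failure_bound_le (p : 'I_4 -> R) (n k : nat) (eps d q : R) :
  let xi := region_size n eps in
  prob_vector p -> admissible n k eps -> 0 < d ->
  k%:R / n%:R <= 1 - entropy p - 2 * d ->
  let a := (entropy p + d) * ln 2 in
  let T0 : {set pstring xi} := [set u | expR (- (xi%:R * a)) <= pweight p u]%SET in
  \sum_(u : pstring xi | pweight p u < expR (- (xi%:R * a))) pweight p u <= q ^+ xi ->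
  failure_bound p n k T0 <=
    n%:R * q ^+ xi + (expR (4 * (n%:R * expR (- (d * ln 2)) ^+ xi)) - 1).
Proof.
move=> xi pp adm d0 hk a T0 hq.
have hk' : entropy p + 2 * d <= 1 - k%:R / n%:R by clear -hk; lra.
case: (admissible_arith adm) => n0 x0 nE kE [oM kx].
have cn : ((n %/ xi).-1.+1 <= n)%N by rewrite [leqRHS]nE leq_pmulr.
have cnR : (n %/ xi).-1.+1%:R <= n%:R :> R by rewrite ler_nat.
have [p0 p1] := pp.
rewrite /failure_bound -/xi; apply: lerD.
  apply: ler_pM => //; first by apply: sumr_ge0 => u _; exact: pweight_ge0.
  apply: le_trans hq; rewrite le_eqVlt; apply/orP; left; apply/eqP.
  by apply: eq_bigl => u; rewrite inE -ltNge.
rewrite lerD2r.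
have ln20 := ln2_gt0.
(* Each typical string weighs at least exp(-xi a), and the weights sum to 1. *)
have card : #|T0|%:R <= expR (xi%:R * a).
  have : #|T0|%:R * expR (- (xi%:R * a)) <= 1.
    rewrite -[leRHS](sum_pweight pp xi) [leRHS](bigID (fun u => u \in T0)) /= -[leLHS]addr0.
    apply: lerD; last by apply: sumr_ge0 => u _; exact: pweight_ge0.
    rewrite mulr_natl -sumr_const; apply: ler_sum => u; by rewrite inE.
  by rewrite expRN ler_pdivrMr ?expR_gt0 // mul1r.
have dec : decay R xi (k * xi %/ n) <= expR (- (xi%:R * ((entropy p + 2 * d) * ln 2))).
  rewrite /decay -[2^-1](lnK (x := 2^-1)) ?posrE ?invr_gt0 // lnV ?posrE //.
  rewrite -expRM_natl (ancilla_count adm) -/xi ler_expR mulrN lerN2 -mulrA.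
  rewrite ler_pM2l ?ltr0n //.
  by rewrite ler_pM2r.
have prod_le : #|T0|%:R * (4 * decay R xi (k * xi %/ n)) <= 4 * expR (- (d * ln 2)) ^+ xi.
  rewrite mulrCA ler_pM2l //; apply: (le_trans (ler_pM _ _ card dec)) => //.
    exact/ltW/decay_gt0.
  rewrite -expRD -expRM_natl ler_expR /a le_eqVlt; apply/orP; left; apply/eqP; ring.
have P0 : 0 <= #|T0|%:R * (4 * decay R xi (k * xi %/ n)).
  by rewrite !mulr_ge0 // ltW // decay_gt0.
set P := #|T0|%:R * _ in prod_le P0 *.
apply: (@le_trans _ _ (expR P ^+ (n %/ xi).-1.+1)).
  by apply: lerXn2r; [rewrite nnegrE addr_ge0 | rewrite nnegrE expR_ge0 | exact: expR_ge1Dx].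
rewrite -expRM_natl ler_expR [leRHS]mulrCA.
by apply: ler_pM; [exact: ler0n | exact: P0 | exact: cnR | exact: prod_le].
Qed.

(** The exponent is at most 1/2, and 4y + 2 (4y)^2 <= 36 y since y <= 1. *)
Lemma expR_small (y : R) : 0 < y <= 8^-1 -> expR (4 * y) <= 1 + 36 * y.
Proof.
by case/andP=> y0 y8; apply: le_trans (expR_le_quad _) _; [lra | nra].
Qed.

(** For every fixed s the error is eventually below s, since the failure probability is at most
    37/n: 1/n from atypical regions and 36/n from collisions. *)
Lemma expected_eventually (p : 'I_4 -> R) (A : set nat) (k : nat -> nat)
    (eps : nat -> R) (delta s : R) :
  prob_vector p -> 0 < delta -> 0 < s ->
  (forall n, A n -> admissible n (k n) (eps n)) ->
  (\forall n \near within A \oo, (k n)%:R / n%:R <= 1 - entropy p - delta) ->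
  log2 n%:R / log2 (n%:R / eps n) @[n --> within A \oo] --> (0 : R) ->
  \forall n \near within A \oo, expected_choi_error p n (k n) (eps n) <= s.
Proof.
move=> pp d0 s0 adm hk ratio; have ln20 := ln2_gt0.
pose d := delta / 2; have dd : 0 < d by rewrite divr_gt0.
pose a := (entropy p + d) * ln 2.
have ha : - \sum_w p w * ln (p w) < a.
  by rewrite -entropyE /a ltr_pM2r // ltrDl.
have [q /andP [q0 q1] hq] := chernoff pp ha.
pose rho := expR (- (d * ln 2)).
have rho0 : 0 < rho := expR_gt0 _.
have rho1 : rho < 1 by rewrite /rho -[ltRHS]expR0 ltr_expR oppr_lt0 mulr_gt0.
pose lam := Num.max q rho.
have lam0 : 0 < lam by rewrite lt_max rho0 orbT.
have lam1 : lam < 1 by rewrite gt_max q1 rho1.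
pose mu := - ln lam.
have mu0 : 0 < mu by rewrite oppr_gt0 ln_lt0 // lam0.
(* With this threshold on the ratio, ln n <= mu xi / 2, so n lam^xi = exp(ln n - mu xi) <= 1/n. *)
have e0 : 0 < mu / (2 * ln 2) by rewrite divr_gt0 // mulr_gt0.
have near_ratio : \forall n \near within A \oo,
    `|0 - log2 n%:R / log2 (n%:R / eps n)| <= mu / (2 * ln 2).
  by move/cvgrPdist_le : ratio; apply.
have near_big : \forall n \near within A \oo, 8 <= (n%:R : R).
  by apply: cvg_within; exact: nbhs_infty_ger.
have near_big' : \forall n \near within A \oo, 37 / s ^+ 2 <= (n%:R : R).
  by apply: cvg_within; exact: nbhs_infty_ger.
have near_A : \forall n \near within A \oo, A n by apply: withinT.
near=> n.
have An : A n by near: n.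
have n8 : 8 <= (n%:R : R) by near: n.
have n37 : 37 / s ^+ 2 <= (n%:R : R) by near: n.
have kn : (k n)%:R / n%:R <= 1 - entropy p - delta by near: n.
have rn : `|0 - log2 n%:R / log2 (n%:R / eps n)| <= mu / (2 * ln 2) by near: n.
have nadm := adm _ An.
case: (admissible_arith nadm) => n0 x0 _ _ _.
set xi := region_size n (eps n) in x0.
have nR : 0 < (n%:R : R) by rewrite ltr0n.
have xR : 0 < (xi%:R : R) by rewrite ltr0n.
have lnn : ln n%:R <= mu / 2 * (xi%:R : R).
  move: rn; rewrite -(log_region nadm) -/xi sub0r normrN => /(le_trans (ler_norm _)).
  rewrite ler_pdivrMr // /log2 ler_pdivrMr //.
  by have -> : mu / (2 * ln 2) * xi%:R * ln 2 = mu / 2 * xi%:R by field; rewrite gt_eqF.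
have lam_xi : n%:R * lam ^+ xi <= n%:R^-1 :> R.
  have -> : lam ^+ xi = expR (- (mu * xi%:R)).
    by rewrite /mu mulNr opprK expRM_natr lnK.
  rewrite -[n%:R](lnK (x := n%:R)) ?posrE // -expRN -expRD ler_expR; lra.
have pow_le x : 0 <= x -> x <= lam -> n%:R * x ^+ xi <= n%:R^-1 :> R.
  move=> hx xl; apply: le_trans lam_xi; rewrite ler_pM2l //.
  by apply: lerXn2r => //; rewrite nnegrE // ltW.
have q_le : n%:R * q ^+ xi <= n%:R^-1 :> R by apply: pow_le => //; rewrite le_max lexx.
have rho_le : n%:R * rho ^+ xi <= n%:R^-1 :> R.
  by apply: pow_le; [exact: ltW | rewrite le_max lexx orbT].
apply: (@expected_le _ _ _ nadm _ pp
  [set u | expR (- (xi%:R * a)) <= pweight p u]%SET) => //.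
have dE : 2 * d = delta by rewrite /d mulrC divfK // pnatr_eq0.
apply: le_trans (failure_bound_le pp nadm dd _ (hq xi)) _; first by rewrite dE.
rewrite -/xi -/rho.
have E : expR (4 * (n%:R * rho ^+ xi)) <= 1 + 36 * n%:R^-1.
  apply: (@le_trans _ _ (expR (4 * n%:R^-1))); first by rewrite ler_expR ler_pM2l.
  by apply: expR_small; rewrite invr_gt0 nR /= lef_pV2 ?posrE.
apply: (@le_trans _ _ (37 * n%:R^-1)).
  rewrite addrA lerBlDr; apply: (le_trans (lerD q_le E)).
  by rewrite le_eqVlt; apply/orP; left; apply/eqP; ring.
have s20 : 0 < s ^+ 2 by rewrite exprn_gt0.
by rewrite ler_pdivrMr // -ler_pdivrMl // mulrC.
Unshelve. all: by end_near. Qed.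

Lemma choi_error_ge0 (L S : finType) (NE : endo R L -> endo R S) : 0 <= choi_error NE.
Proof.
rewrite /choi_error; set E := (X in inf X).
(* The infimum of the empty set is 0 by convention. *)
have [->|/set0P E0] := eqVneq E set0; first by rewrite inf0.
by apply: lb_le_inf => // _ [D _ <-]; exact: sqrtr_ge0.
Qed.

End Asymptotics.

Theorem corollary2 (R : realType) (p : 'I_4 -> R) (hp : prob_vector p) :
  (forall (A : set nat) (k : nat -> nat) (eps : nat -> R) (delta : R),
     0 < delta ->
     (forall n, A n -> admissible n (k n) (eps n)) ->
     (forall n, A n -> (k n)%:R / n%:R <= 1 - entropy p - delta) ->
     log2 n%:R / log2 (n%:R / eps n) @[n --> within A \oo] --> (0 : R) ->
     \forall n \near within A \oo,
       expected_choi_error p n (k n) (eps n) <=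
         Num.sqrt (8 * delta + Num.sqrt (
           2 `^ (- (n%:R * (1 - entropy p - (k n)%:R / n%:R - delta)))
           + 4 * (eps n) `^ (1 - (k n)%:R / n%:R) * n%:R `^ ((k n)%:R / n%:R)
             / log2 (n%:R / eps n)))) /\
  (forall (A : set nat) (k : nat -> nat) (eps : nat -> R) (rate : R),
     (forall n, A n -> admissible n (k n) (eps n)) ->
     0 < rate < 1 - entropy p ->
     (k n)%:R / n%:R @[n --> within A \oo] --> rate ->
     log2 n%:R / log2 (n%:R / eps n) @[n --> within A \oo] --> (0 : R) ->
     expected_choi_error p n (k n) (eps n) @[n --> within A \oo] --> (0 : R)).
Proof.
split=> [A k eps delta d0 adm hk ratio|A k eps rate adm /andP [r0 r1] hrate ratio].
  (* The term 8 delta alone already dominates for large n; the inner square root is only used to be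
     nonnegative. *)
  have s0 : 0 < Num.sqrt (8 * delta) by rewrite sqrtr_gt0 mulr_gt0.
  have hk' : \forall n \near within A \oo, (k n)%:R / n%:R <= 1 - entropy p - delta.
    by apply: filterS (withinT _ _) => n; exact: hk.
  apply: filterS (expected_eventually hp d0 s0 adm hk' ratio) => n /le_trans; apply.
  by apply: ler_wsqrtr; rewrite lerDl sqrtr_ge0.
(* Half of the gap to the hashing bound: once k/n is within d of the rate, a slack d remains. *)
pose d := (1 - entropy p - rate) / 2.
have d0 : 0 < d by rewrite divr_gt0 // subr_gt0.
apply/cvgrPdist_le => e e0.
have hk : \forall n \near within A \oo, (k n)%:R / n%:R <= 1 - entropy p - d.
  move/cvgrPdist_le : hrate => /(_ _ d0); apply: filterS => n.
  by rewrite ler_distlC => /andP [_]; rewrite /d; lra.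
apply: filterS (expected_eventually hp d0 e0 adm hk ratio) => n hn.
rewrite sub0r normrN ger0_norm // /expected_choi_error divr_ge0 //.
by apply: sumr_ge0 => g _; exact: choi_error_ge0.
Qed.
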